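(* Let $N\ge 1$ be an integer, let $m>0$ and $0<\sigma<+\infty$, and consider the conservative discrete Klein-Gordon equation $$\ddot{\phi}_n-(\Delta_d\phi)_n+m\phi_n-|\phi_n|^{2\sigma}\phi_n=0,\quad n\in\mathbb{Z}^N,\ t>0,\qquad \phi(0)=\phi_0,\quad \dot\phi(0)=\phi_1.$$ Consider the function $$\theta(x)=M_0x^{1+\sigma}-x,\quad x\in[0,+\infty),\qquad M_0=\frac{1}{m^{\sigma+1}(\sigma+1)},$$ and set $-\rho:=\min_{x\ge 0}\theta(x)<0$. Assume that the initial data $\psi_0=(\phi_0,\phi_1)\in\ell^2\times\ell^2$ are sufficiently small in the sense that $$\|\psi_0\|_1^2:=\|\phi_1\|_{\ell^2}^2+\|\phi_0\|_{\ell^2_1}^2\le\min\left\{1,\frac{\rho\, m^{\sigma+1}(\sigma+1)}{1+m^{\sigma+1}(\sigma+1)}\right\}.$$ Then the solution satisfies $\phi\in C^2([0,+\infty),\ell^2)$ and $$\sup_{t\ge 0}\left(\|\dot\phi(t)\|_{\ell^2}^2+\|\phi(t)\|_{\ell^2_1}^2\right)\le\frac{1+\sigma}{\sigma}\,\cdot\,\frac{1+m^{\sigma+1}(\sigma+1)}{m^{\sigma+1}(\sigma+1)}\,\|\psi_0\|_1^2.$$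
   Context: $\ell^2$ is the real Hilbert space of square-summable sequences $\phi=\{\phi_n\}_{n\in\mathbb{Z}^N}$, $\phi_n\in\mathbb{R}$, with scalar product $(\phi,\psi)_{\ell^2}=\sum_{n\in\mathbb{Z}^N}\phi_n\psi_n$ and norm $\|\cdot\|_{\ell^2}$. With $e_\kappa$ the $\kappa$-th standard unit vector of $\mathbb{Z}^N$, set $$(\nabla_\kappa^+\phi)_n=\phi_{n+e_\kappa}-\phi_n,\qquad (\Delta_d\phi)_n=\sum_{\kappa=1}^N\big(\phi_{n+e_\kappa}+\phi_{n-e_\kappa}-2\phi_n\big).$$ The norm $\|\cdot\|_{\ell^2_1}$, equivalent to the $\ell^2$ norm, is defined by $$\|\phi\|_{\ell^2_1}^2=\sum_{\kappa=1}^N\|\nabla_\kappa^+\phi\|_{\ell^2}^2+m\|\phi\|_{\ell^2}^2.$$ For every $(\phi_0,\phi_1)\in\ell^2\times\ell^2$ the initial value problem has a unique maximal solution $(\phi,\dot\phi)$, continuous in time with values in $\ell^2\times\ell^2$; ''the solution'' refers to this maximal solution. *)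

(* Defs.v *)
From HB Require Import structures.
From mathcomp Require Import all_boot all_order all_algebra.
From mathcomp Require Import all_classical all_reals all_analysis.
From mathcomp Require Import ring lra.

Set Implicit Arguments.
Unset Strict Implicit.
Unset Printing Implicit Defensive.

Import Order.TTheory GRing.Theory Num.Theory.
Import numFieldNormedType.Exports.

Local Open Scope classical_set_scope.
Local Open Scope ring_scope.

Section ell2.
Variables (R : realType) (T : choiceType).
Implicit Types u v : T -> R.

Definition sqsum u : \bar R := \esum_(n in [set: T]) ((u n) ^+ 2)%:E.

Definition ell2_pred : {pred (T -> R)} := fun u => (sqsum u < +oo)%E.

Lemma sqsum_ge0 u : (0 <= sqsum u)%E.
Proof. by apply: esum_ge0 => n _; rewrite lee_fin sqr_ge0. Qed.

Lemma sqsum_fin u : u \in ell2_pred -> sqsum u \is a fin_num.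
Proof. by move=> hu; rewrite ge0_fin_numE// sqsum_ge0. Qed.

Lemma fsum_sqsum_le u (X : set T) : finite_set X ->
  (\sum_(n \in X) ((u n) ^+ 2)%:E <= sqsum u)%E.
Proof. by move=> fX; apply: ereal_sup_ubound; exists X. Qed.

Lemma sqsum_le_comb u v w a b : 0 <= a -> 0 <= b ->
  (forall n, w n ^+ 2 <= a * u n ^+ 2 + b * v n ^+ 2) ->
  (sqsum w <= a%:E * sqsum u + b%:E * sqsum v)%E.
Proof.
move=> a0 b0 h; apply: ge_ereal_sup => _ [X [fX _] <-].
apply: (@le_trans _ _ (\sum_(n \in X) (a%:E * (u n ^+ 2)%:E + b%:E * (v n ^+ 2)%:E))%E).
  by apply: lee_fsum => // n _; rewrite -!EFinM -EFinD lee_fin.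
rewrite fsbig_split//= -!ge0_mule_fsumr; last 2 first.
- by move=> n; rewrite lee_fin sqr_ge0.
- by move=> n; rewrite lee_fin sqr_ge0.
by apply: leeD; apply: lee_wpmul2l; rewrite ?lee_fin// fsum_sqsum_le.
Qed.

Lemma sqsum_eq0 u : sqsum u = 0%E -> u = 0.
Proof.
move=> u0; apply/funext => n; apply/eqP; rewrite -sqrf_eq0 eq_le sqr_ge0 andbT.
rewrite -lee_fin -[X in (_ <= X)%E]u0.
by have := fsum_sqsum_le u (finite_set1 n); rewrite fsbig_set1.
Qed.

Lemma sqsum0 : sqsum 0 = 0%E.
Proof. by apply: esum1 => n _; rewrite /= expr0n. Qed.

Lemma ell2_submod_closed : submod_closed ell2_pred.
Proof.
split=> [|a u v hu hv]; first by rewrite unfold_in /ell2_pred sqsum0 ltry.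
rewrite unfold_in /ell2_pred.
apply: (@le_lt_trans _ _ ((2 * a ^+ 2)%:E * sqsum u + 2%:E * sqsum v)%E).
  apply: sqsum_le_comb => //; first by rewrite mulr_ge0 ?sqr_ge0.
  move=> n; rewrite !fctE -subr_ge0.
  rewrite (_ : _ - _ = (a * u n - v n) ^+ 2) ?sqr_ge0//.
  by rewrite /GRing.scale/=; ring.
by rewrite ltey_eq fin_numD !fin_numM// sqsum_fin.
Qed.

HB.instance Definition _ :=
  GRing.isSubmodClosed.Build R (T -> R) ell2_pred ell2_submod_closed.

Record ell2 := Ell2 { ell2_fun :> T -> R; _ : ell2_fun \in ell2_pred }.

HB.instance Definition _ := [isSub for ell2_fun].
HB.instance Definition _ := [Choice of ell2 by <:].
HB.instance Definition _ := [SubChoice_isSubLmodule of ell2 by <:].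

Definition ell2_norm (u : ell2) : R := Num.sqrt (fine (sqsum u)).

Lemma sqr_ell2_norm (u : ell2) : (ell2_norm u ^+ 2)%:E = sqsum u.
Proof.
by rewrite sqr_sqrtr ?fine_ge0 ?sqsum_ge0// fineK// sqsum_fin//; exact: (valP u).
Qed.

Lemma ell2_norm_ge0 (u : ell2) : 0 <= ell2_norm u.
Proof. exact: sqrtr_ge0. Qed.

Lemma ell2_norm_eq0 (u : ell2) : ell2_norm u = 0 -> u = 0.
Proof.
move=> u0; apply: val_inj => /=; apply: sqsum_eq0.
by rewrite -sqr_ell2_norm u0 expr0n.
Qed.

Lemma ell2_normZ (a : R) (u : ell2) : ell2_norm (a *: u) = `|a| * ell2_norm u.
Proof.
have le b (v : ell2) : ell2_norm (b *: v) <= `|b| * ell2_norm v.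
  rewrite -(@ler_pXn2r _ 2)// ?nnegrE ?mulr_ge0 ?ell2_norm_ge0//.
  rewrite -lee_fin exprMn (EFinM (`|b| ^+ 2)) !sqr_ell2_norm -[leRHS]adde0.
  rewrite -(mul0e (sqsum v)); apply: sqsum_le_comb; rewrite ?sqr_ge0// => n.
  by rewrite mul0r addr0 real_normK ?num_real// /= fctE exprMn.
apply/eqP; rewrite eq_le le/=; have [->|a0] := eqVneq a 0.
  by rewrite normr0 mul0r ell2_norm_ge0.
have := le a^-1 (a *: u); rewrite scalerA mulVf// scale1r normfV.
by rewrite ler_pdivlMl ?normr_gt0.
Qed.

Lemma ell2_normD (u v : ell2) : ell2_norm (u + v) <= ell2_norm u + ell2_norm v.
Proof.
have [/ell2_norm_eq0 ->|u0] := eqVneq (ell2_norm u) 0.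
  by rewrite add0r lerDr ell2_norm_ge0.
have [/ell2_norm_eq0 ->|v0] := eqVneq (ell2_norm v) 0.
  by rewrite addr0 lerDl ell2_norm_ge0.
have {}u0 : 0 < ell2_norm u by rewrite lt_def u0 ell2_norm_ge0.
have {}v0 : 0 < ell2_norm v by rewrite lt_def v0 ell2_norm_ge0.
rewrite -(@ler_pXn2r _ 2)// ?nnegrE ?addr_ge0 ?ell2_norm_ge0//.
set a := ell2_norm u in u0 *; set b := ell2_norm v in v0 *.
have -> : (a + b) ^+ 2 = (1 + b / a) * a ^+ 2 + (1 + a / b) * b ^+ 2.
  by field; rewrite !gt_eqF.
rewrite -lee_fin EFinD (EFinM _ (a ^+ 2)) (EFinM _ (b ^+ 2)) !sqr_ell2_norm.
have ba0 : 0 < b / a by rewrite divr_gt0.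
have ab0 : 0 < a / b by rewrite divr_gt0.
apply: sqsum_le_comb => [| |n]; [lra|lra|rewrite /= fctE -subr_ge0].
rewrite (_ : _ - _ = (b * u n - a * v n) ^+ 2 / (a * b)).
  by rewrite divr_ge0 ?sqr_ge0// mulr_ge0// ltW.
by field; rewrite !gt_eqF.
Qed.

HB.instance Definition _ :=
  Lmodule_isNormed.Build R ell2 ell2_normD ell2_normZ ell2_norm_eq0.

End ell2.

Lemma ell2_normE (R : realType) (T : choiceType) (u : ell2 R T) :
  `|u| = Num.sqrt (fine (\esum_(n in [set: T]) ((u n) ^+ 2)%:E)).
Proof. by []. Qed.

Section lattice.
Variables (R : realType) (N : nat).

Definition unit_vec (k : 'I_N) : 'rV[int]_N := delta_mx 0 k.

Local Notation l2 := (ell2 R 'rV[int]_N).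

Lemma translate_subproof (a : 'rV[int]_N) (u : l2) :
  (fun n => u (n + a)) \in @ell2_pred R 'rV[int]_N.
Proof.
rewrite unfold_in /ell2_pred; have : (sqsum u < +oo)%E := valP u.
congr (_ < _)%E; rewrite /sqsum.
apply: (reindex_esum _ _ (fun n => n + a) (fun n => ((u n) ^+ 2)%:E)).
split=> //=; first by move=> x y _ _ /addIr.
by move=> y _; exists (y - a) => //; rewrite subrK.
Qed.

Definition translate (a : 'rV[int]_N) (u : l2) : l2 :=
  Ell2 (translate_subproof a u).

Definition nabla (k : 'I_N) (u : l2) : l2 := translate (unit_vec k) u - u.

Definition lap (u : l2) : l2 :=
  \sum_(k < N) (translate (unit_vec k) u + translate (- unit_vec k) u - 2 *: u).

Lemma nablaE k u n : nabla k u n = u (n + unit_vec k) - u n.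
Proof. by []. Qed.

Lemma lapE u n :
  lap u n = \sum_(k < N) (u (n + unit_vec k) + u (n - unit_vec k) - 2 * u n).
Proof. by rewrite /lap; elim/big_rec2: _ => //= k x y _ <-. Qed.

Definition norm21 (m : R) (u : l2) : R :=
  Num.sqrt (\sum_(k < N) `|nabla k u| ^+ 2 + m * `|u| ^+ 2).

(* The square of the norm of the pair (u, v) in l2_1 * l2. *)
Definition norm1_sq (m : R) (u v : l2) : R := `|v| ^+ 2 + norm21 m u ^+ 2.

Definition lifespan (T : \bar R) : set R := [set t | 0 <= t /\ (t%:E < T)%E].

(* dphi is the velocity component of the pair, and only the values of phi and
   dphi on lifespan T are constrained. The equation is imposed site by site at
   positive times; differentiability in the norm of l2 is not assumed. *)
Definition is_solution (m sigma : R) (phi0 phi1 : l2) (T : \bar R)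
    (phi dphi : R -> l2) : Prop :=
  [/\ (0 < T)%E,
      {within lifespan T, continuous phi},
      {within lifespan T, continuous dphi},
      phi 0 = phi0 /\ dphi 0 = phi1 &
      forall (t : R) (n : 'rV[int]_N), 0 < t -> (t%:E < T)%E ->
      [/\ is_derive t 1 (fun s => phi s n) (dphi t n),
          derivable (fun s => dphi s n) t 1 &
          derive1 (fun s => dphi s n) t - lap (phi t) n + m * phi t n
            - `|phi t n| `^ (2 * sigma) * phi t n = 0]].

(* T is the upper end of the existence interval [0, T), possibly +oo. *)
Definition is_maximal_solution (m sigma : R) (phi0 phi1 : l2) (T : \bar R)
    (phi dphi : R -> l2) : Prop :=
  is_solution m sigma phi0 phi1 T phi dphi /\
  forall (T' : \bar R) (phi' dphi' : R -> l2), (T <= T')%E ->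
    is_solution m sigma phi0 phi1 T' phi' dphi' ->
    (forall t, lifespan T t -> phi' t = phi t /\ dphi' t = dphi t) ->
    T' = T.

End lattice.

Section Ck.
Variables (R : realType) (V : normedModType R).

(* The difference quotient only takes values in D, so this is the one-sided
   derivative at an endpoint of an interval. *)
Definition is_derive_within (D : set R) (f : R -> V) (t : R) (l : V) : Prop :=
  (s - t)^-1 *: (f s - f t) @[s --> within D t^'] --> l.

Fixpoint Ck_on (k : nat) (D : set R) (f : R -> V) : Prop :=
  {within D, continuous f} /\
  if k is k'.+1 then
    exists2 f' : R -> V,
      forall t, D t -> is_derive_within D f t (f' t) & Ck_on k' D f'
  else True.

End Ck.

Definition is_min (R : realType) (A : set R) (x : R) : Prop := A x /\ lbound A x.

Definition M0 (R : realType) (m sigma : R) : R :=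
  1 / (m `^ (sigma + 1) * (sigma + 1)).

Definition theta (R : realType) (m sigma x : R) : R :=
  M0 m sigma * x `^ (1 + sigma) - x.

(* Main.v *)
(* The energy |dphi|^2 + x - (1/(sigma+1)) sum_n |phi_n|^(2 sigma+2), where x is
   the square of the l2_1 norm of phi, is conserved; as m |phi|^2 <= x, it is at
   least |dphi|^2 - theta(x). Young's inequality gives
   rho = sigma/(sigma+1) x*, attained at x* = m^((sigma+1)/sigma). Since the
   initial energy is < rho, x(t) starts below x* and can never cross it, and below
   x* one has -theta(x) >= sigma/(sigma+1) x, whence the bound.
   To get a global solution without continuation arguments, the nonlinearity is
   frozen outside [-M, M] with m M^2 = x*. The force is then globally Lipschitz on
   l2, the Picard iteration converges on all of [0, +oo[, and the barrier x < x*
   keeps every coordinate in [-M, M], so that the truncation is never active.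
   Uniqueness and maximality identify this solution with the given one.
   Statements on l2-valued curves are reduced to scalar calculus by testing
   against finitely supported vectors. *)
Require Import Defs.
From mathcomp Require Import all_boot all_order all_algebra.
From mathcomp Require Import all_classical all_reals all_analysis.
From mathcomp Require Import ring lra.

Set Implicit Arguments.
Unset Strict Implicit.
Unset Printing Implicit Defensive.

Import Order.TTheory GRing.Theory Num.Theory.
Import numFieldNormedType.Exports.

Local Open Scope classical_set_scope.
Local Open Scope ring_scope.

(** * Sums of squares and the scalar product of l2 *)

Section finite_sums.
Variables (R : realType) (T : choiceType).
Implicit Types (f : T -> R) (s : seq T) (u v w : ell2 R T).

(** Without continuation, the barrier and global existence would each presuppose the other. The
    truncated force is therefore built as the gradient of a potential of its own, convex and with a
    quadratic Taylor bound: its flow is global and conserves its own energy before any bound on the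
    size of the solution is known. At the level [M] one has [M ^ (2 sigma) = m], so on [[-M, M]] the
    power [|s| ^ (2 sigma + 2)] is at most [m s ^ 2], and the mass term alone absorbs the potential.
    A solution comes only with coordinatewise derivatives. They are derivatives in norm because
    velocity and force are continuous in norm; this gives the chain rule for the energy at positive
    times and C^2 regularity up to time 0, where the equation is not imposed. *)

Lemma esum_seq_ge f s : (forall n, 0 <= f n) -> uniq s ->
  ((\sum_(n <- s) f n)%:E <= \esum_(n in [set: T]) (f n)%:E)%E.
Proof.
move=> f0 us; rewrite -sumEFin; apply: esum_ge.
exists [set` s]; first by split => //; exact: finite_seq.
by rewrite -fsbig_seq.
Qed.

Lemma esum_seq_le f (C : R) :
  (forall s, uniq s -> \sum_(n <- s) f n <= C) ->
  (\esum_(n in [set: T]) (f n)%:E <= C%:E)%E.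
Proof.
move=> h; apply: ge_ereal_sup => _ [X [fX _] <-].
by rewrite fsbig_finite//= sumEFin lee_fin h// finmap.fset_uniq.
Qed.

Lemma esumZ f (c : R) : 0 <= c ->
  (\esum_(n in [set: T]) (c * f n)%:E
   = c%:E * \esum_(n in [set: T]) (f n)%:E)%E.
Proof.
move=> c0; rewrite /esum -ereal_supZl//; last first.
  apply/set0P; exists (\sum_(n \in (set0 : set T)) (f n)%:E)%E => /=.
  by exists set0 => //; exact: fsets_set0.
congr ereal_sup; rewrite image_comp; apply: eq_imagel => X [fX _] /=.
rewrite !fsbig_finite//= !sumEFin -EFinM; congr EFin.
by rewrite mulr_sumr.
Qed.

(* [fine] sends +oo to 0: [sumr] is only meaningful on [pos_summable] families. *)
Definition sumr f : R := fine (\esum_(n in [set: T]) (f n)%:E).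

Definition pos_summable f : Prop :=
  (forall n, 0 <= f n) /\ (\esum_(n in [set: T]) (f n)%:E < +oo)%E.

Lemma sumrE f : pos_summable f ->
  (sumr f)%:E = (\esum_(n in [set: T]) (f n)%:E)%E.
Proof.
move=> [f0 fo]; rewrite fineK// ge0_fin_numE//.
by apply: esum_ge0 => n _; rewrite lee_fin.
Qed.

(** Sums in the extended reals are additive only for nonnegative terms, so each coefficient is split
    into positive and negative parts. The result transfers any pointwise linear inequality between
    finitely many series to their sums. *)
Lemma sumr_comb_ge0 (l : seq (R * (T -> R))) :
  (forall p, p \in l -> pos_summable p.2) ->
  (forall n, 0 <= \sum_(p <- l) p.1 * p.2 n) ->
  0 <= \sum_(p <- l) p.1 * sumr p.2.
Proof.
move=> sl hl.
have comb (c : R -> R) : (forall x, 0 <= c x) ->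
    (\esum_(n in [set: T]) (\sum_(p <- l) c p.1 * p.2 n)%:E)%E
    = (\sum_(p <- l) c p.1 * sumr p.2)%:E.
  move=> c0; elim: l sl {hl} => [|p l ih] sl.
    by rewrite big_nil; apply: esum1 => n _; rewrite big_nil.
  have sp : pos_summable p.2 by apply: sl; rewrite inE eqxx.
  have {}sl q : q \in l -> pos_summable q.2.
    by move=> ql; apply: sl; rewrite inE ql orbT.
  rewrite big_cons EFinD EFinM sumrE// -esumZ// -ih// -esumD.
  - by apply: eq_esum => n _; rewrite big_cons.
  - by move=> n _; rewrite lee_fin mulr_ge0//; case: sp.
  - move=> n _; rewrite lee_fin big_seq; apply: sumr_ge0 => q /sl[q0 _].
    exact: mulr_ge0.
have c1 (x : R) : 0 <= Num.max x 0 by rewrite le_max lexx orbT.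
have c2 (x : R) : 0 <= Num.max (- x) 0 by rewrite le_max lexx orbT.
have cE (x y : R) : x * y = Num.max x 0 * y - Num.max (- x) 0 * y.
  rewrite -mulrBl; congr (_ * _).
  by case: (leP x 0) => x0; rewrite /Num.max; case: ifPn; lra.
rewrite (eq_bigr _ (fun p _ => cE p.1 _)) sumrB subr_ge0 -lee_fin.
rewrite -(comb _ c1) -(comb _ c2); apply: le_esum => n _.
rewrite lee_fin -subr_ge0 -sumrB.
by rewrite -(eq_bigr _ (fun p _ => cE p.1 _)).
Qed.

Lemma sumr_comb_eq0 (l : seq (R * (T -> R))) :
  (forall p, p \in l -> pos_summable p.2) ->
  (forall n, \sum_(p <- l) p.1 * p.2 n = 0) ->
  \sum_(p <- l) p.1 * sumr p.2 = 0.
Proof.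
move=> sl hl; apply: le_anti; rewrite (sumr_comb_ge0 sl) ?andbT; last first.
  by move=> n; rewrite hl.
pose l' := [seq (- p.1, p.2) | p <- l].
have := @sumr_comb_ge0 l'; rewrite !big_map/=.
rewrite (eq_bigr (fun p => - (p.1 * sumr p.2))); last by move=> p _; rewrite
  mulNr.
rewrite sumrN oppr_ge0; apply.
  by move=> _ /mapP[q /sl ? ->].
move=> n; rewrite big_map/= (eq_bigr (fun p => - (p.1 * p.2 n))); last first.
  by move=> p _; rewrite mulNr.
by rewrite sumrN hl oppr0.
Qed.

Lemma sqr_summable u : pos_summable (fun n => u n ^+ 2).
Proof. by split; [move=> n; exact: sqr_ge0|exact: (valP u)]. Qed.

Lemma sqr_norm_ell2 u : `|u| ^+ 2 = sumr (fun n => u n ^+ 2).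
Proof. by rewrite -[LHS]/(fine (`|u| ^+ 2)%:E) sqr_ell2_norm. Qed.

Lemma sum_sqr_le_norm u s : uniq s -> \sum_(n <- s) u n ^+ 2 <= `|u| ^+ 2.
Proof.
move=> us; rewrite -lee_fin sqr_ell2_norm.
by apply: (@esum_seq_ge (fun n => u n ^+ 2)) => // n; exact: sqr_ge0.
Qed.

Lemma norm_ell2_le u (C : R) : 0 <= C ->
  (forall s, uniq s -> \sum_(n <- s) u n ^+ 2 <= C ^+ 2) -> `|u| <= C.
Proof.
move=> C0 h; rewrite -(@ler_pXn2r _ 2)// ?nnegrE//.
rewrite -lee_fin sqr_ell2_norm.
exact: (@esum_seq_le (fun n => u n ^+ 2)).
Qed.

Lemma sum_sqr_bounded_ell2 f (C : R) :
  (forall s, uniq s -> \sum_(n <- s) f n ^+ 2 <= C) -> f \in @ell2_pred R T.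
Proof.
move=> h; rewrite unfold_in.
by apply: le_lt_trans (ltry C); exact: (@esum_seq_le (fun n => f n ^+ 2)).
Qed.

Lemma ell2_coord_le u n : `|u n| <= `|u|.
Proof.
rewrite -(@ler_pXn2r _ 2)// ?nnegrE// real_normK ?num_real//.
by have := @sum_sqr_le_norm u [:: n]; rewrite big_seq1; exact.
Qed.

Lemma dominated_ell2 f u (a : R) : (forall n, `|f n| <= a * `|u n|) ->
  f \in @ell2_pred R T.
Proof.
move=> h; apply: (@sum_sqr_bounded_ell2 _ (a ^+ 2 * `|u| ^+ 2)) => s us.
apply: (@le_trans _ _ (a ^+ 2 * \sum_(n <- s) u n ^+ 2)).
  rewrite mulr_sumr; apply: ler_sum => n _.
  rewrite -[f n ^+ 2]real_normK ?num_real// -[u n ^+ 2]real_normK ?num_real//.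
  by rewrite -exprMn ler_pXn2r// ?nnegrE// (le_trans _ (h n)).
by rewrite ler_wpM2l ?sqr_ge0// sum_sqr_le_norm.
Qed.

Lemma norm_ell2_mono u v (a : R) : 0 <= a -> (forall n, `|u n| <= a * `|v n|) ->
  `|u| <= a * `|v|.
Proof.
move=> a0 h; apply: norm_ell2_le => [|s us]; first by rewrite mulr_ge0.
rewrite exprMn; apply: (@le_trans _ _ (a ^+ 2 * \sum_(n <- s) v n ^+ 2)).
  rewrite mulr_sumr; apply: ler_sum => n _.
  rewrite -[u n ^+ 2]real_normK ?num_real// -[v n ^+ 2]real_normK ?num_real//.
  by rewrite -exprMn ler_pXn2r// ?nnegrE// mulr_ge0.
by rewrite ler_wpM2l ?sqr_ge0// sum_sqr_le_norm.
Qed.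

(** Polarization spares a theory of absolutely convergent series: bilinearity reduces to identities
    between squares, checked coordinate by coordinate. *)
Definition dot u v : R := (`|u + v| ^+ 2 - `|u| ^+ 2 - `|v| ^+ 2) / 2.

Lemma dotC u v : dot u v = dot v u.
Proof. by rewrite /dot [v + u]addrC; ring. Qed.

Lemma sqr_normD u v : `|u + v| ^+ 2 = `|u| ^+ 2 + 2 * dot u v + `|v| ^+ 2.
Proof. by rewrite /dot; field. Qed.

Let sqr_norm_comb_eq0 (l : seq (R * ell2 R T)) :
  (forall n, \sum_(p <- l) p.1 * p.2 n ^+ 2 = 0) ->
  \sum_(p <- l) p.1 * `|p.2| ^+ 2 = 0.
Proof.
move=> h; pose l' := [seq (p.1, fun n => (p.2 : ell2 R T) n ^+ 2) | p <- l].
have := @sumr_comb_eq0 l'; rewrite big_map/=.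
under eq_bigr do rewrite -sqr_norm_ell2; apply.
  by move=> _ /mapP[q _ ->]; exact: sqr_summable.
by move=> n; rewrite big_map/= h.
Qed.

Lemma dotDl u v w : dot (u + v) w = dot u w + dot v w.
Proof.
(* The three-vector parallelogram identity: the squares of [u + v + w], [u], [v], [w] and those of
   the three pairwise sums have the same total. *)
have := @sqr_norm_comb_eq0 [:: (1, u + v + w); (1, u); (1, v); (1, w);
  (-1, u + v); (-1, u + w); (-1, v + w)].
rewrite !big_cons big_nil/= /dot => h.
apply/eqP; rewrite -subr_eq0; apply/eqP.
rewrite -[RHS](mul0r (2^-1)) -h; last first.
  by move=> n; rewrite !big_cons big_nil/= !fctE; ring.
by field.
Qed.

Lemma dotZl (a : R) u w : dot (a *: u) w = a * dot u w.
Proof.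
have := @sqr_norm_comb_eq0 [:: (1, a *: u + w); (a, u); (a, w);
  (- a ^+ 2, u); (-1, w); (- a, u + w)].
rewrite !big_cons big_nil/= /dot => h.
rewrite normrZ exprMn real_normK ?num_real//.
apply/eqP; rewrite -subr_eq0; apply/eqP.
rewrite -[RHS](mul0r (2^-1)) -h; last first.
  by move=> n; rewrite !big_cons big_nil/= !fctE /GRing.scale/=; ring.
by field.
Qed.

Lemma dotDr u v w : dot u (v + w) = dot u v + dot u w.
Proof. by rewrite !(dotC u) dotDl. Qed.

Lemma dotZr (a : R) u w : dot u (a *: w) = a * dot u w.
Proof. by rewrite !(dotC u) dotZl. Qed.

Lemma dotNl u v : dot (- u) v = - dot u v.
Proof. by rewrite -scaleN1r dotZl mulN1r. Qed.

Lemma dotBl u v w : dot (u - v) w = dot u w - dot v w.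
Proof. by rewrite dotDl dotNl. Qed.

Lemma dotBr u v w : dot u (v - w) = dot u v - dot u w.
Proof. by rewrite !(dotC u) dotBl. Qed.

Lemma dot0l u : dot 0 u = 0.
Proof. by rewrite -(scale0r 0) dotZl mul0r. Qed.

Lemma dot_suml (I : Type) (r : seq I) (F : I -> ell2 R T) u :
  dot (\sum_(i <- r) F i) u = \sum_(i <- r) dot (F i) u.
Proof. by apply: (big_morph (dot^~ u)) => [x y|]; rewrite ?dotDl ?dot0l. Qed.

(** Cauchy-Schwarz is the square of the triangle inequality already available for the norm;
    replacing [u] by [- u] gives the other sign. *)
Lemma dot_norm_le u v : `|dot u v| <= `|u| * `|v|.
Proof.
have le w z : dot w z <= `|w| * `|z|.
  have : `|w + z| ^+ 2 <= (`|w| + `|z|) ^+ 2.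
    by rewrite ler_pXn2r// ?nnegrE ?addr_ge0// ler_normD.
  by rewrite sqr_normD sqrrD mulr2n; lra.
by rewrite ler_norml le andbT lerNl -dotNl -[`|u|]normrN le.
Qed.

End finite_sums.

(** * Mean value inequality from coordinatewise derivatives *)

Lemma cauchy_schwarz_seq (R : realType) (I : Type) (s : seq I) (x y : I -> R) :
  (\sum_(i <- s) x i * y i) ^+ 2
  <= (\sum_(i <- s) x i ^+ 2) * (\sum_(i <- s) y i ^+ 2).
Proof.
elim: s => [|i s ih]; first by rewrite !big_nil mul0r expr0n.
rewrite !big_cons.
set S := (X in (_ + X) ^+ 2) in ih *; set A := \sum_(j <- s) x j ^+ 2 in ih *.
set B := \sum_(j <- s) y j ^+ 2 in ih *.
have A0 : 0 <= A by apply: sumr_ge0 => j _; exact: sqr_ge0.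
have B0 : 0 <= B by apply: sumr_ge0 => j _; exact: sqr_ge0.
have [A00|A00] := eqVneq A 0.
  have -> : S = 0 by apply/eqP; rewrite -sqrf_eq0 eq_le sqr_ge0 andbT (le_trans
    ih)// A00 mul0r.
  rewrite A00; have := sqr_ge0 (x i); have := sqr_ge0 (y i); nra.
have {}A0 : 0 < A by rewrite lt_def A00.
have := sqr_ge0 (x i * S - A * y i).
rewrite -subr_ge0 => h; rewrite -subr_ge0 -(pmulr_rge0 _ A0).
(* Multiplying by [A > 0] completes the square and leaves the induction hypothesis with a
   nonnegative factor. *)
have -> : A * ((x i ^+ 2 + A) * (y i ^+ 2 + B) - (x i * y i + S) ^+ 2)
   = (x i * S - A * y i) ^+ 2 + (x i ^+ 2 + A) * (A * B - S ^+ 2) by ring.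
by rewrite subr0 in h; rewrite addr_ge0// mulr_ge0 ?subr_ge0// addr_ge0
  ?sqr_ge0// ltW.
Qed.

Lemma within_continuous_comp (X Y Z : topologicalType) (A : set X) (f : X -> Y)
    (g : Y -> Z) :
  {within A, continuous f} -> continuous g ->
  {within A, continuous (fun x => g (f x))}.
Proof.
move=> cf cg x; apply: (@continuous_comp (subspace A) Y Z f g x).
  exact: cf.
exact: cg.
Qed.

(** The constant may depend on [u] and only the unit ball around [u] matters, as is natural for
    functionals of quadratic growth such as the energy. *)
Lemma pointwise_lipschitz_continuous (R : realType) (V W : normedModType R)
    (f : V -> W) :
  (forall u, exists K, forall v, `|u - v| <= 1 -> `|f u - f v| <= K * `|u - v|)
    ->
  continuous f.
Proof.
move=> hf u; have [K hK] := hf u; apply/cvgrPdist_le => e e0; near=> v.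
have K0 : 0 < `|K| + 1 by rewrite ltr_wpDl.
apply: (@le_trans _ _ ((`|K| + 1) * (e / (`|K| + 1)))); last first.
  by rewrite mulrCA divff ?mulr1// gt_eqF.
have v1 : `|u - v| <= 1 by near: v; apply: cvgr_dist_le => //; exact: cvg_id.
apply: (le_trans (hK v v1)); apply: (@le_trans _ _ ((`|K| + 1) * `|u - v|)).
  by rewrite ler_wpM2r// (le_trans (ler_norm _))// lerDl.
rewrite ler_pM2l//; near: v; apply: cvgr_dist_le; last by rewrite divr_gt0.
exact: cvg_id.
Unshelve. all: by end_near. Qed.

Lemma lipschitz_fun_continuous (R : realType) (V W : normedModType R) (f : V ->
  W)
    (K : R) :
  (forall u v, `|f u - f v| <= K * `|u - v|) -> continuous f.
Proof.
by move=> hf; apply: pointwise_lipschitz_continuous => u; exists K => v _.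
Qed.

Section mean_value.
Variables (R : realType) (T : choiceType).
Local Notation l2 := (ell2 R T).

Lemma is_derive_sum_seq (s : seq T) (w g : T -> R) (f : R -> T -> R) (t : R) :
  (forall n, is_derive t 1 (f^~ n) (g n)) ->
  is_derive t 1 (fun x => \sum_(n <- s) w n * f x n) (\sum_(n <- s) w n * g n).
Proof.
move=> df; elim: s => [|n s ih].
  rewrite big_nil (_ : (fun _ => _) = cst 0); first exact: is_derive_cst.
  by apply/funext => x; rewrite big_nil.
rewrite big_cons (_ : (fun _ => _) =
    (w n \*: (f^~ n)) \+ (fun x => \sum_(i <- s) w i * f x i)).
  by apply: is_deriveD; apply: is_deriveZ.
by apply/funext => x; rewrite big_cons.
Qed.

Lemma continuous_sum_seq (X : topologicalType) (s : seq T) (w : T -> R)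
    (f : X -> T -> R) :
  (forall n, continuous (f^~ n)) ->
  continuous (fun x => \sum_(n <- s) w n * f x n).
Proof.
move=> cf; elim: s => [|n s ih] x.
  rewrite (_ : (fun _ => _) = cst 0); first exact: cvg_cst.
  by apply/funext => y; rewrite big_nil.
rewrite (_ : (fun _ => _) =
    (fun y => w n * f y n) \+ (fun y => \sum_(i <- s) w i * f y i)).
  apply: continuousD; last exact: ih.
  by apply: continuousM; [exact: cvg_cst|exact: cf].
by apply/funext => y; rewrite big_cons.
Qed.

(* The increment of f is tested against itself, which reduces the claim to the
   scalar mean value theorem. *)
Lemma mean_value_seq (f : R -> T -> R) (g : R -> l2) (h h' : R -> R) (a b : R) :
  a <= b ->
  (forall n, {within `[a, b], continuous (f^~ n)}) ->
  (forall n t, a < t < b -> is_derive t 1 (f^~ n) (g t n)) ->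
  {within `[a, b], continuous h} ->
  (forall t, a < t < b -> is_derive t 1 h (h' t)) ->
  (forall t, a < t < b -> `|g t| <= h' t) ->
  forall s, uniq s ->
  \sum_(n <- s) (f b n - f a n) ^+ 2 <= (h b - h a) ^+ 2.
Proof.
rewrite le_eqVlt => /predU1P[-> _ _ _ _ _ s _|ab cf df ch dh gh s us].
  rewrite subrr expr0n/= big1// => n _.
  by rewrite subrr expr0n.
pose w n := f b n - f a n.
set A := \sum_(n <- s) _.
have A0 : 0 <= A by apply: sumr_ge0 => n _; exact: sqr_ge0.
have hab : 0 <= h b - h a.
  have [c cab ->] := MVT ab (fun t ht => dh t ht) ch.
  rewrite mulr_ge0 ?subr_ge0 ?(ltW ab)//.
  by apply: le_trans (gh _ _) => //; rewrite in_itv in cab.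
(* Subtracting [sqrt A * h] merges the tested increment and its majorant into one scalar function,
   so that a single intermediate point serves both. *)
have [c cab] : exists2 c, c \in `]a, b[%R &
    (\sum_(n <- s) w n * f b n - Num.sqrt A * h b)
    - (\sum_(n <- s) w n * f a n - Num.sqrt A * h a)
    = (\sum_(n <- s) w n * g c n - Num.sqrt A * h' c) * (b - a).
  have := @MVT _ ((fun t => \sum_(n <- s) w n * f t n) \- (Num.sqrt A \*: h))
    (fun t => \sum_(n <- s) w n * g t n - Num.sqrt A * h' t) _ _ ab.
  apply.
    move=> t tab; apply: is_deriveB.
      by apply: is_derive_sum_seq => n; apply: df; rewrite in_itv in tab.
    by apply: is_deriveZ; apply: dh; rewrite in_itv in tab.
  move=> x; apply: (@continuousB _ _ (subspace `[a, b])).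
    exact: (@continuous_sum_seq (subspace `[a, b])).
  apply: (@continuousM _ (subspace `[a, b]) (cst (Num.sqrt A)) h).
    exact: cvg_cst.
  exact: ch.
rewrite in_itv/= in cab => E.
have : \sum_(n <- s) w n * g c n <= Num.sqrt A * h' c.
  apply: le_trans (ler_norm _) _.
  have h'0 : 0 <= h' c by apply: le_trans (gh _ cab).
  rewrite -(@ler_pXn2r _ 2)// ?nnegrE ?mulr_ge0 ?sqrtr_ge0//.
  rewrite real_normK ?num_real// (le_trans (cauchy_schwarz_seq _ _ _))//.
  rewrite exprMn sqr_sqrtr// ler_wpM2l//.
  rewrite (le_trans (sum_sqr_le_norm _ us))// ler_pXn2r ?nnegrE//.
  exact: gh.
rewrite -subr_le0 => le0.
have {}le0 : \sum_(n <- s) w n * f b n - \sum_(n <- s) w n * f a n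
    <= Num.sqrt A * (h b - h a).
  have ba0 : 0 <= b - a by rewrite subr_ge0 ltW.
  by have := mulr_le0_ge0 le0 ba0; rewrite -E; lra.
have AE : \sum_(n <- s) w n * f b n - \sum_(n <- s) w n * f a n = A.
  by rewrite -sumrB; apply: eq_bigr => n _; rewrite -mulrBr.
rewrite AE in le0 *.
rewrite -[leLHS]sqr_sqrtr// ler_pXn2r ?nnegrE ?sqrtr_ge0//.
have [A00|A00] := eqVneq (Num.sqrt A) 0; first by rewrite A00.
have As : 0 < Num.sqrt A by rewrite lt_def A00 sqrtr_ge0.
by rewrite -(ler_pM2l As) -expr2 sqr_sqrtr.
Qed.

Lemma mean_value_ell2 (f g : R -> l2) (h h' : R -> R) (a b : R) :
  a <= b ->
  (forall n, {within `[a, b], continuous (fun t => f t n)}) ->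
  (forall n t, a < t < b -> is_derive t 1 (fun x => f x n) (g t n)) ->
  {within `[a, b], continuous h} ->
  (forall t, a < t < b -> is_derive t 1 h (h' t)) ->
  (forall t, a < t < b -> `|g t| <= h' t) ->
  h a <= h b ->
  `|f b - f a| <= h b - h a.
Proof.
move=> ab cf df ch dh gh hab; apply: norm_ell2_le; first by rewrite subr_ge0.
exact: (@mean_value_seq (fun t => f t) g h h').
Qed.

Lemma continuous_coord n : continuous (fun u : l2 => u n).
Proof.
apply: (@lipschitz_fun_continuous _ l2 R _ 1) => u v; rewrite mul1r.
exact: (ell2_coord_le (u - v) n).
Qed.

Lemma continuous_within_coord (A : set R) (f : R -> l2) n :
  {within A, continuous f} -> {within A, continuous (fun t => f t n)}.
Proof.
move=> cf.
exact: (@within_continuous_comp R l2 R A f (fun u => u n) cf (@continuous_coord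
  n)).
Qed.

Lemma mean_value_lip (f g : R -> l2) (a b C : R) :
  a <= b ->
  (forall n, {within `[a, b], continuous (fun t => f t n)}) ->
  (forall n t, a < t < b -> is_derive t 1 (fun x => f x n) (g t n)) ->
  0 <= C -> (forall t, a < t < b -> `|g t| <= C) ->
  `|f b - f a| <= C * (b - a).
Proof.
move=> ab cf df C0 gC; rewrite mulrBr.
have lin (t : R) : is_derive t 1 (fun x : R => C * x) C.
  have := is_deriveZ C (is_derive_id t (1 : R)).
  by rewrite /GRing.scale/= mulr1.
apply: (@mean_value_ell2 f g (fun x => C * x) (fun=> C)) => //.
- apply: continuous_subspaceT => x.
  by apply: differentiable_continuous; apply/derivable1_diffP.
- by rewrite ler_wpM2l.
Qed.

End mean_value.

(** * Primitives and second-order equations with Lipschitz force *)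

(** The constant depends on the right end only: the curves concerned are constant for negative
    times. *)
Lemma locally_lipschitz_continuous (R : realType) (V : normedModType R)
    (f : R -> V) :
  (forall b : R, exists2 C, 0 <= C &
    forall s t, s <= t -> t <= b -> `|f t - f s| <= C * (t - s)) ->
  continuous f.
Proof.
move=> hf t; have [C C0 hC] := hf (t + 1).
have C1 : 0 < C + 1 by rewrite ltr_wpDl.
apply/cvgrPdist_le => e e0; near=> s.
have st : `|t - s| <= e / (C + 1).
  near: s; apply: cvgr_dist_le; last by rewrite divr_gt0.
  exact: cvg_id.
have s1 : s <= t + 1.
  by near: s; apply: lt_le_nbhsl; rewrite ltrDl.
have {}st : C * `|t - s| <= e.
  rewrite (le_trans (ler_wpM2l C0 st))// mulrCA ger_pMr// ler_pdivrMr// mul1r.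
  by rewrite lerDl.
apply: le_trans st; have [st|st] := leP s t.
  by rewrite (ger0_norm (_ : 0 <= t - s)) ?subr_ge0// hC// lerDl.
rewrite distrC (distrC t) (ger0_norm (_ : 0 <= s - t)) ?subr_ge0 ?(ltW st)//.
by rewrite hC// ltW.
Unshelve. all: by end_near. Qed.

Section primitive.
Variables (R : realType) (T : choiceType).
Local Notation l2 := (ell2 R T).

Lemma continuous_norm_bounded (V : normedModType R) (f : R -> V) (a b : R) :
  {within `[a, b], continuous f} ->
  exists2 C, 0 <= C & forall t, a <= t <= b -> `|f t| <= C.
Proof.
move=> cf; have [ab|ba] := leP a b; last first.
  by exists 0 => // t /andP[at_ tb]; have := le_trans at_ tb; rewrite leNgt ba.
have cn : {within `[a, b], continuous (fun t => `|f t|)}.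
  exact: (within_continuous_comp cf (@norm_continuous _ V)).
have [c _ hc] := EVT_max ab cn.
by exists `|f c| => // t tab; apply: hc; rewrite in_itv.
Qed.

(** Each coordinate is integrated separately; square summability and continuity in norm come
    afterwards from the mean value inequality. Extending by 0 to negative times makes continuity
    two-sided on all of R. *)
Lemma primitive_ell2 (g : R -> l2) : continuous g ->
  exists G : R -> l2, [/\ continuous G, forall t : R, t <= 0 -> G t = 0 &
    forall n (t : R), 0 < t -> is_derive t 1 (fun s => G s n) (g t n)].
Proof.
move=> cg.
have cgn n : continuous (fun t => g t n).
  move=> t; apply: (@continuous_comp _ l2 _ g (fun u : l2 => u n)).
    exact: cg.
  exact: continuous_coord.
pose mu := @lebesgue_measure R.
pose G t n : R := parameterized_integral mu 0 t (fun s => g s n).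
have intg (n : T) (b : R) : mu.-integrable `[0, b] (EFin \o (fun s => g s n)).
  by apply: continuous_compact_integrable; [exact: segment_compact|exact:
    continuous_subspaceT].
have dG (n : T) (t : R) : 0 < t -> is_derive t 1 (G^~ n) (g t n).
  (* The interval reaches [t + 1] so that [t] is interior. *)
  move=> t0; have [d1 d2] := @continuous_FTC1_closed R (fun s => g s n) 0 t (t
    + 1)
    (ltr_pwDr ltr01 (lexx t)) (intg n (t + 1)) t0 (cgn n t).
  by split => //; rewrite -derive1E.
have cG (n : T) (b : R) : 0 <= b -> {within `[0, b], continuous (G^~ n)}.
  by move=> b0; apply: parameterized_integral_continuous.
have G0 (t : R) (n : T) : t <= 0 -> G t n = 0.
  rewrite le_eqVlt => /predU1P[->|t0]; rewrite /G /parameterized_integral.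
    by rewrite set_itv1 Rintegral_set1.
  by rewrite set_itv_ge ?Rintegral_set0// bnd_simp -ltNge.
have GP (t : R) : G t \in @ell2_pred R T.
  have [t0|t0] := leP t 0.
    rewrite (_ : G t = 0); first exact: rpred0.
    by apply/funext => n; rewrite G0.
  have [C C0 hC] := @continuous_norm_bounded l2 g 0 t (continuous_subspaceT cg).
  apply: (@sum_sqr_bounded_ell2 _ _ _ ((C * t - C * 0) ^+ 2)) => s us.
  (* The version on finite sums is required here, since [G t] is not yet known to lie in l2. *)
  have := @mean_value_seq R T G g (fun x => C * x) (fun=> C) 0 t (ltW t0)
    (fun n => cG n t (ltW t0)).
  rewrite (eq_bigr (fun n => (G t n - G 0 n) ^+ 2)); last first.
    by move=> n _; rewrite (G0 0 n (lexx 0)) subr0.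
  apply => //.
  - by move=> n x /andP[x0 _]; exact: dG.
  - apply: continuous_subspaceT => x.
    by apply: differentiable_continuous; apply/derivable1_diffP; apply:
      derivableM.
  - move=> x _; have := is_deriveZ C (is_derive_id x (1 : R)).
    by rewrite /GRing.scale/= mulr1.
  - by move=> x /andP[x0 xt]; apply: hC; rewrite !ltW.
exists (fun t => Ell2 (GP t)); split => //; last first.
  by move=> t t0; apply: val_inj; apply/funext => n /=; rewrite G0.
apply: (@locally_lipschitz_continuous R l2) => b.
have [C C0 hC] := @continuous_norm_bounded l2 g 0 b (continuous_subspaceT cg).
exists C => //.
have lip s t : 0 <= s -> s <= t -> t <= b ->
    `|Ell2 (GP t) - Ell2 (GP s)| <= C * (t - s).
  move=> s0 st tb; apply: (@mean_value_lip _ _ (fun t => Ell2 (GP t)) g) => //.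
  - move=> n; apply: (@continuous_subspaceW _ _ _ `[0, t]).
      by apply: subset_itvr; rewrite bnd_simp.
    exact/cG/(le_trans s0).
  - move=> n x /andP[sx _]; apply: dG; exact: le_lt_trans sx.
  - move=> x /andP[sx xt]; apply: hC; rewrite (le_trans s0 (ltW sx)).
    by rewrite (le_trans (ltW xt)).
have E0 t : t <= 0 -> Ell2 (GP t) = Ell2 (GP 0).
  by move=> t0; apply: val_inj; apply/funext => n /=; rewrite !G0.
move=> s t st tb; have [s0|s0] := leP 0 s; first exact: lip.
rewrite (E0 s (ltW s0)); have [t0|t0] := leP 0 t.
  rewrite (le_trans (lip 0 t _ _ _))// ler_wpM2l// lerD2l lerN2.
  exact: ltW.
by rewrite (E0 t (ltW t0)) subrr normr0 mulr_ge0// subr_ge0.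
Qed.

End primitive.

(** * Global existence and uniqueness for a Lipschitz force *)

Section global_ode.
Variables (R : realType) (T : choiceType).
Local Notation l2 := (ell2 R T).

(** One integration divides an exponential weight by its rate [c]; two of them beat the Lipschitz
    constant once [c] is large. *)
Lemma exp_mean_value (f g : R -> l2) (B c D : R) :
  0 < c -> 0 <= D ->
  (forall n, {within `[0, B], continuous (fun t => f t n)}) ->
  f 0 = 0 ->
  (forall n (t : R), 0 < t < B -> is_derive t 1 (fun s => f s n) (g t n)) ->
  (forall t, 0 < t < B -> `|g t| <= D * expR (c * t)) ->
  forall t, 0 <= t <= B -> `|f t| <= D / c * expR (c * t).
Proof.
move=> c0 D0 cf f0 df gD t /andP[t0 tB].
have dh (s : R) : is_derive s 1 (fun x => D / c * expR (c * x))
    (D * expR (c * s)).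
  have dc : is_derive s 1 (fun x : R => c * x) c.
    by have := is_deriveZ c (is_derive_id s (1 : R)); rewrite /GRing.scale/=
      mulr1.
  have := is_deriveZ (D / c) (is_derive1_comp (is_derive_expR (c * s)) dc).
  rewrite /GRing.scale/= (_ : D / c * _ = D * expR (c * s))//.
  by field; rewrite gt_eqF.
have tsub : `[0, t]%classic `<=` `[0, B]%classic.
  by apply: subset_itvl; rewrite bnd_simp.
have h0t : D / c * expR (c * 0) <= D / c * expR (c * t).
  by rewrite ler_wpM2l ?divr_ge0 ?(ltW c0)// ler_expR ler_wpM2l// ltW.
have := @mean_value_ell2 _ _ f g (fun x => D / c * expR (c * x))
  (fun x => D * expR (c * x)) 0 t t0.
rewrite f0 subr0 => mv; apply: le_trans (mv _ _ _ _ _ _) _ => //.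
- by move=> n; exact: continuous_subspaceW tsub (cf n).
- move=> n x /andP[x0 xt]; apply: df; rewrite x0; exact: lt_le_trans xt tB.
- apply: continuous_subspaceT => x.
  by apply: differentiable_continuous; apply/derivable1_diffP.
- move=> x /andP[x0 xt]; apply: gD; rewrite x0; exact: lt_le_trans xt tB.
- by rewrite lerBlDr lerDl mulr_ge0 ?expR_ge0// divr_ge0// ltW.
Qed.

Lemma geometric_small (C e : R) : 0 <= C -> 0 < e -> exists k : nat, C / 2 ^+ k
  <= e.
Proof.
move=> C0 e0; exists (Num.bound (C / e)).
rewrite ler_pdivrMr ?exprn_gt0// mulrC -ler_pdivrMr//.
have := archi_boundP (divr_ge0 C0 (ltW e0)) => /ltW/le_trans; apply.
by rewrite -natrX ler_nat ltnW// ltn_expl.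
Qed.

Lemma geometric_le0 (x C : R) : 0 <= C -> (forall k : nat, x <= C / 2 ^+ k) ->
  x <= 0.
Proof.
move=> C0 h; apply/ler_addgt0Pr => e e0; rewrite add0r.
by have [k /(le_trans (h k))] := geometric_small C0 e0.
Qed.

Lemma geometric_telescope (V : normedModType R) (u : nat -> V) (C : R) :
  0 <= C -> (forall k, `|u k.+1 - u k| <= C / 2 ^+ k) ->
  forall k j, `|u k - u (k + j)%N| <= 2 * C / 2 ^+ k.
Proof.
move=> C0 h k j.
(* The tail is kept in the induction, which would not close on the bound [2 * C / 2 ^+ k] alone. *)
suff H : `|u k - u (k + j)%N| <= 2 * C / 2 ^+ k - 2 * C / 2 ^+ (k + j).
  by apply: (le_trans H); rewrite lerBlDr lerDl divr_ge0 ?exprn_ge0// mulr_ge0.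
elim: j => [|j ih]; first by rewrite addn0 !subrr normr0.
rewrite (_ : u k - _ = (u k - u (k + j)%N) - (u (k + j).+1 - u (k + j)%N));
  last first.
  by rewrite addnS opprB addrA subrK.
apply: (le_trans (ler_normB _ _)); apply: (le_trans (lerD ih (h _))).
rewrite addnS exprS; set x := 2 ^+ (k + j).
have x0 : x != 0 by rewrite expf_neq0.
rewrite (_ : 2 * C / (2 * x) = C / x); last by field.
by lra.
Qed.

(* The limit is taken coordinatewise; the norm bound passes to the limit along
   finite sums. *)
Lemma geometric_limit (u : nat -> l2) (C : R) :
  0 <= C -> (forall k, `|u k.+1 - u k| <= C / 2 ^+ k) ->
  exists v : l2, forall k, `|u k - v| <= 2 * C / 2 ^+ k.
Proof.
move=> C0 h; have tel := geometric_telescope C0 h.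
have cv n : cvgn (fun k => u k n).
  apply/cauchy_cvgP/cauchy_exP => e e0.
  have [k hk] := geometric_small (mulr_ge0 (ler0n R 2) C0) (divr_gt0 e0 (ltr0n
    _ 2)).
  exists (u k n); exists k => //= j /= kj; rewrite -ball_normE /ball_/=.
  apply: le_lt_trans (ell2_coord_le (u k - u j) n) _.
  rewrite -(subnKC kj) (le_lt_trans (tel _ _))// (le_lt_trans hk)//.
  by rewrite ltr_pdivrMr// ltr_pMr// ltr1n.
pose v n := limn (fun k => u k n).
have bound k (s : seq T) : uniq s ->
    \sum_(n <- s) (u k n - v n) ^+ 2 <= (2 * C / 2 ^+ k) ^+ 2.
  move=> us; apply: (@cvgr_to_le _ \oo _ _ (fun j => \sum_(n <- s) (u k n - u j
    n) ^+ 2)).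
    apply: cvg_big => [|n _]; first exact: add_continuous.
    have : u k n - u j n @[j --> \oo] --> u k n - v n.
      by apply: cvgB; [exact: cvg_cst|exact: cv].
    by move=> cj; rewrite expr2; exact: (cvgM cj cj).
  exists k => //= j /= kj; apply: le_trans (sum_sqr_le_norm (u k - u j) us) _.
  have D0 : 0 <= 2 * C / 2 ^+ k by rewrite divr_ge0 ?exprn_ge0// mulr_ge0.
  by rewrite ler_pXn2r ?nnegrE// -(subnKC kj) tel.
have dP k : (fun n => u k n - v n) \in @ell2_pred R T.
  exact: (sum_sqr_bounded_ell2 (bound k)).
have vE : v = (u 0%N : T -> R) - (fun n => u 0%N n - v n).
  by apply/funext => n; rewrite !fctE opprB addrC subrK.
have vP : v \in @ell2_pred R T by rewrite vE rpredB//; exact: (valP (u 0%N)).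
exists (Ell2 vP) => k; apply: norm_ell2_le.
  by rewrite divr_ge0 ?exprn_ge0// mulr_ge0.
exact: bound.
Qed.

Lemma geometric_uniform_continuous (V : normedModType R) (x : nat -> R -> V)
    (y : R -> V) :
  (forall k, continuous (x k)) ->
  (forall B : R, exists2 C, 0 <= C &
    forall k t, t <= B -> `|x k t - y t| <= C / 2 ^+ k) ->
  continuous y.
Proof.
move=> cx hxy t; have [C C0 hC] := hxy (t + 1).
apply/cvgrPdist_le => e e0.
have [k hk] := geometric_small C0 (divr_gt0 e0 (ltr0n _ 3)).
near=> s.
rewrite (_ : y t - y s = - (x k t - y t) + (x k t - x k s) + (x k s - y s));
  last first.
  by rewrite opprB !subrKA.
have -> : e = e / 3 + e / 3 + e / 3 by field.
rewrite (le_trans (ler_normD _ _))// lerD//; last first.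
  apply: le_trans hk; apply: hC; near: s; apply: lt_le_nbhsl; by rewrite ltrDl.
rewrite (le_trans (ler_normD _ _))// lerD//.
  by rewrite normrN (le_trans _ hk)// hC// lerDl.
near: s; apply: cvgr_dist_le; last by rewrite divr_gt0.
exact: cx.
Unshelve. all: by end_near. Qed.

Variables (F : l2 -> l2) (L : R).
Hypotheses (L0 : 0 <= L) (F_lip : forall u v, `|F u - F v| <= L * `|u - v|).

Let F_continuous : continuous F.
Proof. exact: (lipschitz_fun_continuous F_lip). Qed.

Variables (phi0 phi1 : l2).

(** The force is evaluated along the old curve [y], while the new position integrates the new
    velocity; a solution of the equation is a pair [x] with [picard_next x.1 x]. *)
Definition picard_next (y : R -> l2) (x : (R -> l2) * (R -> l2)) : Prop :=
  [/\ continuous x.1, continuous x.2,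
      forall t : R, t <= 0 -> x.1 t = phi0 /\ x.2 t = phi1 &
      forall n (t : R), 0 < t ->
        is_derive t 1 (fun s => x.1 s n) (x.2 t n) /\
        is_derive t 1 (fun s => x.2 s n) (F (y t) n)].

Lemma shifted_primitive (u : l2) (g : R -> l2) : continuous g ->
  exists G : R -> l2, [/\ continuous G, forall t : R, t <= 0 -> G t = u &
    forall n (t : R), 0 < t -> is_derive t 1 (fun s => G s n) (g t n)].
Proof.
move=> /primitive_ell2[G [cG G0 dG]].
exists (fun t => u + G t); split.
- by move=> t; apply: continuousD; [exact: cvg_cst|exact: cG].
- by move=> t /G0 ->; rewrite addr0.
- move=> n t /dG dGt.
  have := is_deriveD (is_derive_cst (u n) t 1) (dGt n).
  by rewrite add0r.
Qed.

Lemma picard_next_exists (y : R -> l2) : continuous y ->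
  exists x, picard_next y x.
Proof.
move=> cy; have cFy : continuous (F \o y).
  by move=> t; apply: (@continuous_comp _ l2 l2); [exact: cy|exact:
    F_continuous].
have [z [cz z0 dz]] := shifted_primitive phi1 cFy.
have [x [cx x0 dx]] := shifted_primitive phi0 cz.
by exists (x, z); split => // [t t0|n t t0]; split; auto.
Qed.

(* [exp (rate * t)] is the weight of the Bielecki norm for which two successive
   integrations of an [L]-Lipschitz force contract by a factor 1/2. *)
Let rate : R := 2 * L + 1.

Let rate_gt0 : 0 < rate.
Proof. by rewrite ltr_wpDl// mulr_ge0. Qed.

(** Only data on [[0, B]] enter, so that the estimate serves both the convergence of the iteration
    and uniqueness for curves that solve the equation on a bounded interval. *)
Let half_estimate (y z w : R -> l2) (B D : R) :
  0 <= D ->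
  (forall n, {within `[0, B], continuous (fun t => y t n)}) ->
  (forall n, {within `[0, B], continuous (fun t => z t n)}) ->
  y 0 = 0 -> z 0 = 0 ->
  (forall n (t : R), 0 < t < B -> is_derive t 1 (fun s => y s n) (z t n)) ->
  (forall n (t : R), 0 < t < B -> is_derive t 1 (fun s => z s n) (w t n)) ->
  (forall t, 0 < t < B -> `|w t| <= L * (D * expR (rate * t))) ->
  forall t, 0 <= t <= B -> `|y t| <= D / 2 * expR (rate * t).
Proof.
move=> D0 cy cz y0 z0 dy dz hw t tB.
have LD0 : 0 <= L * D by rewrite mulr_ge0.
have hz : forall t, 0 <= t <= B -> `|z t| <= L * D / rate * expR (rate * t).
  by apply: (@exp_mean_value _ w) => // s sB; rewrite -mulrA hw.
apply: (@le_trans _ _ (L * D / rate / rate * expR (rate * t))).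
  apply: (@exp_mean_value _ z B) => // [|s /andP[s0 sB]].
    by rewrite divr_ge0// ltW.
  by rewrite hz// !ltW.
(* The factor [L / rate ^ 2] is at most 1/2 because [(2 L + 1) ^ 2 >= 2 L]. *)
rewrite ler_wpM2r ?expR_ge0// ler_pdivrMr// ler_pdivrMr// -subr_ge0.
rewrite (_ : _ - _ = D * (2 * L ^+ 2 + L + 1 / 2)); last by rewrite /rate;
  field.
by rewrite mulr_ge0// !addr_ge0// mulr_ge0// exprn_ge0.
Qed.

Let within_coordB (A : set R) (f g : R -> l2) n :
  {within A, continuous f} -> {within A, continuous g} ->
  {within A, continuous (fun t => (f t - g t) n)}.
Proof.
move=> cf cg; apply: (@continuous_within_coord _ _ _ (fun t => f t - g t)).
by move=> t; apply: continuousB; [exact: cf|exact: cg].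
Qed.

Let half_contraction (y y' : R -> l2) x x' (B D : R) :
  0 <= D -> picard_next y x -> picard_next y' x' ->
  (forall t, 0 <= t <= B -> `|y t - y' t| <= D * expR (rate * t)) ->
  forall t, 0 <= t <= B -> `|x.1 t - x'.1 t| <= D / 2 * expR (rate * t).
Proof.
move=> D0 [cx cz x0 dx] [cx' cz' x0' dx'] hy.
have [[x00 z00] [x00' z00']] := (x0 0 (lexx 0), x0' 0 (lexx 0)).
apply: (@half_estimate _ (fun t => x.2 t - x'.2 t) (fun t => F (y t) - F (y'
  t))) => //.
- by move=> n; apply: within_coordB; exact: continuous_subspaceT.
- by move=> n; apply: within_coordB; exact: continuous_subspaceT.
- by rewrite x00 x00' subrr.
- by rewrite z00 z00' subrr.
- move=> n t /andP[t0 _]; have [d1 _] := dx n t t0; have [d2 _] := dx' n t t0.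
  exact: (is_deriveB d1 d2).
- move=> n t /andP[t0 _]; have [_ d1] := dx n t t0; have [_ d2] := dx' n t t0.
  exact: (is_deriveB d1 d2).
- move=> t /andP[t0 tB]; rewrite (le_trans (F_lip _ _))// ler_wpM2l//.
  by apply: hy; rewrite !ltW.
Qed.

(** Two solutions differ by a bounded amount on [[0, B]]; feeding this bound back into
    [half_estimate] halves it each time, so the weighted difference of positions is 0. *)
Lemma global_ode_unique (y z y' z' : R -> l2) (B : R) :
  {within `[0, B], continuous y} -> {within `[0, B], continuous z} ->
  {within `[0, B], continuous y'} -> {within `[0, B], continuous z'} ->
  y 0 = y' 0 -> z 0 = z' 0 ->
  (forall n (t : R), 0 < t < B -> is_derive t 1 (fun s => y s n) (z t n)) ->
  (forall n (t : R), 0 < t < B -> is_derive t 1 (fun s => z s n) (F (y t) n)) ->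
  (forall n (t : R), 0 < t < B -> is_derive t 1 (fun s => y' s n) (z' t n)) ->
  (forall n (t : R), 0 < t < B -> is_derive t 1 (fun s => z' s n) (F (y' t) n))
    ->
  forall t, 0 <= t <= B -> y t = y' t /\ z t = z' t.
Proof.
move=> cy cz cy' cz' y0 z0 dy dz dy' dz'.
have cd : {within `[0, B], continuous (fun t => y t - y' t)}.
  by move=> t; apply: continuousB; [exact: cy|exact: cy'].
have [C C0 hC] := @continuous_norm_bounded _ l2 _ _ _ cd.
have hk k : forall t, 0 <= t <= B ->
    `|y t - y' t| <= C / 2 ^+ k * expR (rate * t).
  elim: k => [t tB|k ih].
    rewrite expr0 divr1 (le_trans (hC _ tB))// ler_peMr// -expR0 ler_expR.
    by case/andP: tB => t0 _; rewrite mulr_ge0// ltW.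
  have D0 : 0 <= C / 2 ^+ k by rewrite divr_ge0// exprn_ge0.
  rewrite exprSr invfM mulrA.
  apply: (@half_estimate _ (fun t => z t - z' t) (fun t => F (y t) - F (y' t)))
    => //.
  - by move=> n; exact: within_coordB.
  - by move=> n; exact: within_coordB.
  - by rewrite y0 subrr.
  - by rewrite z0 subrr.
  - by move=> n t tB; exact: (is_deriveB (dy n t tB) (dy' n t tB)).
  - by move=> n t tB; exact: (is_deriveB (dz n t tB) (dz' n t tB)).
  - move=> t /andP[t0 tB]; rewrite (le_trans (F_lip _ _))// ler_wpM2l//.
    by apply: ih; rewrite !ltW.
have yE t : 0 <= t <= B -> y t = y' t.
  move=> tB; apply/eqP; rewrite -subr_eq0 -normr_le0.
  apply: (@geometric_le0 _ (C * expR (rate * t))) => [|k].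
    by rewrite mulr_ge0// expR_ge0.
  by rewrite mulrAC hk.
move=> t tB; split; first exact: yE.
apply/eqP; rewrite -subr_eq0 -normr_le0.
(* With [D = 0]: once the positions agree, the difference of the velocities has zero derivative. *)
have := @exp_mean_value (fun t => z t - z' t) (fun t => F (y t) - F (y' t)) B 1
  0
  ltr01 (lexx 0).
rewrite !mul0r => /(_ _ _ _ _ t tB); rewrite mul0r; apply => //.
- by move=> n; exact: within_coordB.
- by rewrite z0 subrr.
- by move=> n s sB; exact: (is_deriveB (dz n s sB) (dz' n s sB)).
- by move=> s /andP[s0 sB]; rewrite mul0r yE ?subrr ?normr0// !ltW.
Qed.

Lemma global_ode_exists : exists x, picard_next x.1 x.
Proof.
(* The pair of zero curves is a dummy value on discontinuous [y]. *)
have [S hS] : {S : (R -> l2) -> (R -> l2) * (R -> l2) &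
    forall y, continuous y -> picard_next y (S y)}.
  apply: (@choice _ _ (fun y x => continuous y -> picard_next y x)) => y.
  have [/picard_next_exists[x px]|ncy] := pselect (continuous y).
    by exists x.
  by exists (cst 0, cst 0) => cy; case: ncy.
pose X k := iter k (fun x => S x.1) (cst phi0, cst phi1).
have cX k : continuous (X k).1.
  elim: k => [|k ih]; first by move=> t; exact: cvg_cst.
  by case: (hS _ ih).
have pX k : picard_next (X k).1 (X k.+1) by apply: hS.
have X0 k t : t <= 0 -> (X k).1 t = phi0.
  by case: k => [//|k] t0; case: (pX k) => _ _ /(_ t t0)[].
have dX (B : R) : exists2 C, 0 <= C &
    forall t, t <= B -> forall k, `|(X k.+1).1 t - (X k).1 t| <= C / 2 ^+ k.
  have [C C0 hC] := @continuous_norm_bounded _ l2 (fun t => (X 1%N).1 t - (X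
    0%N).1 t) 0 B
    (continuous_subspaceT (fun t => continuousB (@cX 1%N t) (@cX 0%N t))).
  have hk k : forall t, 0 <= t <= B ->
      `|(X k.+1).1 t - (X k).1 t| <= C / 2 ^+ k * expR (rate * t).
    elim: k => [t tB|k ih t tB].
      rewrite expr0 divr1 (le_trans (hC _ tB))// ler_peMr// -expR0 ler_expR.
      by case/andP: tB => t0 _; rewrite mulr_ge0// ltW.
    have D0 : 0 <= C / 2 ^+ k by rewrite divr_ge0// exprn_ge0.
    have := half_contraction D0 (pX k.+1) (pX k) ih tB.
    by rewrite exprSr invfM mulrA.
  (* The weight at [|B|] dominates the weight at every [t] in [[0, B]]; for negative [t] the
     iterates all equal [phi0]. *)
  exists (C * expR (rate * `|B|)) => [|t tB k].
    by rewrite mulr_ge0// expR_ge0.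
  have [t0|t0] := leP 0 t; last first.
    rewrite !X0 ?(ltW t0)// subrr normr0 divr_ge0 ?exprn_ge0//.
    by rewrite mulr_ge0// expR_ge0.
  rewrite mulrAC (le_trans (hk k t _)) ?t0// ler_wpM2l ?divr_ge0 ?exprn_ge0//.
  by rewrite ler_expR ler_wpM2l ?(ltW rate_gt0)// (le_trans tB)// ler_norm.
(* [C] is quantified inside the choice because one limit at [t] must satisfy the estimates of every
   horizon [B]. *)
have [Y hY] : {Y : R -> l2 & forall t (C : R), 0 <= C ->
    (forall k, `|(X k.+1).1 t - (X k).1 t| <= C / 2 ^+ k) ->
    forall k, `|(X k).1 t - Y t| <= 2 * C / 2 ^+ k}.
  apply: (@choice _ _ (fun t v => forall C : R, 0 <= C ->
    (forall k, `|(X k.+1).1 t - (X k).1 t| <= C / 2 ^+ k) ->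
    forall k, `|(X k).1 t - v| <= 2 * C / 2 ^+ k)) => t.
  have [C C0 /(_ t (lexx t)) hC] := dX t.
  have [v hv] := @geometric_limit (fun k => (X k).1 t) C C0 hC.
  exists v => C' C'0 hC' k.
  rewrite -subr_le0; apply: (@geometric_le0 _ (2 * C)) => [|j].
    by rewrite mulr_ge0.
  rewrite lerBlDl -(subrKA ((X (k + j)%N).1 t)) (le_trans (ler_normD _ _))//.
  apply: lerD.
    exact: (@geometric_telescope l2 (fun k => (X k).1 t) C' C'0 hC' k j).
  rewrite (le_trans (hv _))// ler_wpM2l ?mulr_ge0//.
  by rewrite lef_pV2 ?posrE ?exprn_gt0// ler_eXn2l ?ltr1n// leq_addl.
have hYB (B : R) : exists2 C, 0 <= C &
    forall k t, t <= B -> `|(X k).1 t - Y t| <= C / 2 ^+ k.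
  have [C C0 hC] := dX B; exists (2 * C); first by rewrite mulr_ge0.
  by move=> k t tB; apply: hY => // j; exact: hC.
have cY : continuous Y.
  by apply: (@geometric_uniform_continuous l2 (fun k => (X k).1)).
have pY := hS Y cY.
suff YE : (S Y).1 = Y by exists (S Y); rewrite YE.
apply/funext => t; have [t0|t0] := leP t 0.
  have [_ _ /(_ t t0)[-> _] _] := pY.
  apply/eqP; rewrite -subr_eq0 -normr_le0.
  have [C C0 hC] := hYB t; apply: (geometric_le0 C0) => k.
  by have := hC k t (lexx t); rewrite X0.
apply/eqP; rewrite -subr_eq0 -normr_le0.
have [C C0 hC] := hYB t.
apply: (@geometric_le0 _ (C / 2 * expR (rate * t) + C)) => [|k].
  by rewrite addr_ge0// mulr_ge0 ?expR_ge0// divr_ge0.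
(* Compare through the iterate [k + 1]: contraction controls its distance to [S Y], convergence its
   distance to [Y]. *)
rewrite mulrDl -(subrKA ((X k.+1).1 t)) (le_trans (ler_normD _ _))// lerD//.
  have D0 : 0 <= C / 2 ^+ k by rewrite divr_ge0// exprn_ge0.
  rewrite mulrAC [C / 2 / _]mulrAC.
  have tt' : 0 <= t <= t by rewrite (ltW t0) lexx.
  have hs : forall s, 0 <= s <= t ->
      `|Y s - (X k).1 s| <= C / 2 ^+ k * expR (rate * s); last first.
    exact: (half_contraction D0 pY (pX k) hs tt').
  move=> s /andP[s0 st]; rewrite distrC (le_trans (hC k s st))// ler_peMr//.
  by rewrite -expR0 ler_expR mulr_ge0// ltW.
rewrite (le_trans (hC k.+1 t (lexx t)))// ler_wpM2l// lef_pV2 ?posrE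
  ?exprn_gt0//.
by rewrite ler_eXn2l ?ltr1n.
Qed.

End global_ode.

(** * Strong differentiability *)

Section strong_derivative.
Variables (R : realType).

(** The little-o form, free of division by [s - t], is what mean value bounds produce and what the
    chain rule consumes. *)
Definition diff_within (V : normedModType R) (D : set R) (f : R -> V) (t : R)
    (l : V) : Prop :=
  forall e, 0 < e -> exists2 d, 0 < d &
    forall s, D s -> `|s - t| < d -> `|f s - f t - (s - t) *: l| <= e * `|s -
      t|.

Lemma diff_within_is_derive_within (V : normedModType R) (D : set R)
    (f : R -> V) (t : R) (l : V) :
  diff_within D f t l -> is_derive_within D f t l.
Proof.
move=> hf; apply/cvgrPdist_le => e /hf[d d0 hd].
apply/nbhs_ballP; exists d => //= s; rewrite -ball_normE/= => std st Ds.
have st0 : s - t != 0 by rewrite subr_eq0.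
have -> : l - (s - t)^-1 *: (f s - f t)
    = - ((s - t)^-1 *: (f s - f t - (s - t) *: l)).
  by rewrite [in RHS]scalerBr scalerK// opprB.
rewrite distrC in std.
by rewrite normrN normrZ normfV ler_pdivrMl ?normr_gt0// mulrC hd.
Qed.

Lemma diff_within_is_derive (f : R -> R) (t l : R) :
  diff_within [set: R] f t l -> is_derive t 1 f l.
Proof.
move=> hf.
have cvf : h^-1 *: ((f \o shift t) (h *: 1) - f t) @[h --> 0^'] --> l.
  apply/cvgrPdist_le => e /hf[d d0 hd].
  apply/nbhs_ballP; exists d => //= h; rewrite -ball_normE/= sub0r normrN =>
    hd1 h0.
  have := hd (h + t) I; rewrite addrK => /(_ hd1) hd2.
  rewrite -(ler_pM2l (_ : 0 < `|h|)) ?normr_gt0//.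
  rewrite -normrM mulrBr distrC /GRing.scale/= mulr1 mulrA mulfV// mul1r.
  by rewrite [leRHS]mulrC.
by split; [apply/cvg_ex; exists l|exact: cvg_lim].
Qed.

Lemma within_continuous_dist (V : normedModType R) (D : set R) (f : R -> V) :
  {within D, continuous f} -> forall t, D t -> forall e, 0 < e ->
  exists2 d, 0 < d & forall s, D s -> `|s - t| < d -> `|f s - f t| <= e.
Proof.
move=> /subspace_continuousP cf t Dt e e0.
have /cvgrPdist_le/(_ e e0)/nbhs_ballP[d /= d0 hd] := cf t Dt.
exists d => // s Ds st; rewrite distrC; apply: hd => //=.
by rewrite -ball_normE/= distrC.
Qed.

Lemma within_continuousD (V : normedModType R) (D : set R) (f g : R -> V) :
  {within D, continuous f} -> {within D, continuous g} ->
  {within D, continuous (fun x => f x + g x)}.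
Proof. by move=> cf cg x; apply: continuousD; [exact: cf|exact: cg]. Qed.

Lemma within_continuousB (V : normedModType R) (D : set R) (f g : R -> V) :
  {within D, continuous f} -> {within D, continuous g} ->
  {within D, continuous (fun x => f x - g x)}.
Proof. by move=> cf cg x; apply: continuousB; [exact: cf|exact: cg]. Qed.

Variable T : choiceType.
Local Notation l2 := (ell2 R T).

(** Near [t] the curve [x |-> f x - x *: g t] has coordinatewise derivative [g x - g t], small in
    norm by continuity of [g]; the mean value inequality then bounds its increment. The endpoint 0
    is included because only interior derivatives are used. *)
Lemma coordinatewise_diff_within (f g : R -> l2) :
  {within `[0, +oo[, continuous f} -> {within `[0, +oo[, continuous g} ->
  (forall n (t : R), 0 < t -> is_derive t 1 (fun s => f s n) (g t n)) ->
  forall t : R, 0 <= t -> diff_within `[0, +oo[ f t (g t).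
Proof.
move=> cf cg df t t0 e e0.
have Dt : (`[0, +oo[%classic : set R) t by rewrite /= in_itv/= t0.
have [d d0 hd] := @within_continuous_dist l2 _ _ cg t Dt e e0.
exists d => // s; rewrite /= in_itv/= andbT => s0 st.
have cfg : {within `[0, +oo[, continuous (fun x : R => f x - x *: g t)}.
  have cl : {within `[0, +oo[, continuous (fun x : R => x *: g t)}.
    by apply: continuous_subspaceT => y; exact: (@scalel_continuous _ l2).
  exact: (within_continuousB cf cl).
have key a b : 0 <= a -> a <= b ->
    (forall x, a < x < b -> `|x - t| < d) ->
    `|(f b - b *: g t) - (f a - a *: g t)| <= e * (b - a).
  move=> a0 ab hx.
  apply: (@mean_value_lip _ _ (fun x => f x - x *: g t) (fun x => g x - g t))
    => //.
  - move=> n; apply: (@continuous_within_coord _ _ _ (fun x => f x - x *: g t)).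
    apply: continuous_subspaceW cfg => x /=.
    by rewrite !in_itv/= andbT => /andP[ax _]; exact: le_trans ax.
  - move=> n x /andP[ax _].
    have dx : is_derive x 1 (fun y : R => (f y - y *: g t) n) (g x n - g t n).
      have h1 := df n x (le_lt_trans a0 ax).
      have h2 := is_deriveZ (g t n) (is_derive_id x (1 : R)).
      have := is_deriveB h1 h2; rewrite /GRing.scale/= mulr1.
      congr is_derive; apply/funext => y.
      by transitivity (f y n - y * g t n) => //; congr (_ - _); exact: mulrC.
    exact: dx.
  - exact: ltW.
  - move=> x axb; apply: hd; last exact: hx.
    by rewrite /= in_itv/= andbT (le_trans a0)//; case/andP: axb => /ltW.
have -> : f s - f t - (s - t) *: g t = (f s - s *: g t) - (f t - t *: g t).
  by rewrite scalerBl !opprB [t *: _ - _]addrC addrACA [- f t + _]addrC.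
have [ts|ts] := leP t s.
  rewrite (ger0_norm (_ : 0 <= s - t)) ?subr_ge0//; apply: key => // x /andP[tx
    xs].
  rewrite gtr0_norm ?subr_gt0//; apply: lt_trans st.
  by rewrite gtr0_norm ?subr_gt0 ?(lt_trans tx)// ltrD2r.
rewrite distrC (distrC s t) (ger0_norm (_ : 0 <= t - s)) ?subr_ge0 ?(ltW ts)//.
apply: key => // [|x /andP[sx xt]]; first exact: ltW.
rewrite distrC gtr0_norm ?subr_gt0//; apply: lt_trans st.
by rewrite distrC gtr0_norm ?subr_gt0 ?(lt_trans sx)// ltrD2l ltrN2.
Qed.

Lemma quadratic_continuous (Phi : l2 -> R) (gam : l2 -> l2) (C : R) :
  (forall a b, `|Phi a - Phi b - dot (gam b) (a - b)| <= C * `|a - b| ^+ 2) ->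
  continuous Phi.
Proof.
move=> hPhi; apply: (@pointwise_lipschitz_continuous _ l2) => b.
exists (`|C| + `|gam b|) => a; rewrite !(distrC b) (distrC (Phi b)) => ab.
rewrite -(subrK (dot (gam b) (a - b)) (Phi a - Phi b)) mulrDl.
rewrite (le_trans (ler_normD _ _))// lerD//; last exact: dot_norm_le.
rewrite (le_trans (hPhi _ _))// expr2 mulrA ler_wpM2r//.
rewrite (le_trans (ler_wpM2r _ (ler_norm C)))// ler_piMr//.
Qed.

(* A Taylor bound with quadratic remainder replaces Frechet differentiability of
   [Phi]; [gam] is its gradient. *)
Lemma quadratic_chain_rule (Phi : l2 -> R) (gam : l2 -> l2) (K : R) (f : R ->
  l2)
    (t : R) (l : l2) :
  0 <= K ->
  (forall a b, `|Phi a - Phi b - dot (gam b) (a - b)| <= K * `|a - b| ^+ 2) ->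
  0 < t -> diff_within `[0, +oo[ f t l ->
  is_derive t 1 (fun s => Phi (f s)) (dot (gam (f t)) l).
Proof.
move=> K0 hPhi t0 df; apply: diff_within_is_derive => e e0.
set gt_ := gam (f t).
have e1 : 0 < Num.min 1 (e / 2 / (`|gt_| + 1)).
  by rewrite lt_min ltr01/= !divr_gt0// ltr_wpDl.
have [d d0 hd] := df _ e1.
have k1 : 0 < K * (`|l| + 1) ^+ 2 + 1 by rewrite ltr_wpDl// mulr_ge0// sqr_ge0.
(* [d] makes the linear error at most [e / 2 * |s - t|], [t] keeps [s] in the half-line, and the
   last entry makes the quadratic remainder at most [e / 2 * |s - t|]. *)
exists (Num.min (Num.min d t) (e / 2 / (K * (`|l| + 1) ^+ 2 + 1))).
  by rewrite !lt_min d0 t0/= !divr_gt0.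
move=> s _; rewrite !lt_min => /andP[/andP[sd st] se].
have Ds : (`[0, +oo[%classic : set R) s.
  rewrite /= in_itv/= andbT.
  by move: st; rewrite distrC ltr_distlC => /andP[+ _]; rewrite subrr => /ltW.
have := hd s Ds sd; set w := f s - f t - _; set x := `|s - t| in sd st se * =>
  hw.
have x0 : 0 <= x by exact: normr_ge0.
have fE : f s - f t = w + (s - t) *: l by rewrite /w subrK.
have w1 : `|w| <= x.
  by rewrite (le_trans hw)// ler_piMl// ge_min lexx.
have w2 : `|gt_| * `|w| <= e / 2 * x.
  have : `|w| <= e / 2 / (`|gt_| + 1) * x.
    by rewrite (le_trans hw)// ler_wpM2r// ge_min lexx orbT.
  move=> /(ler_wpM2l (normr_ge0 gt_))/le_trans; apply.
  rewrite mulrA ler_wpM2r// mulrCA ger_pMr ?divr_gt0// ler_pdivrMr ?mul1r.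
    by rewrite lerDl.
  by rewrite ltr_wpDl.
have f1 : `|f s - f t| <= (`|l| + 1) * x.
  rewrite fE (le_trans (ler_normD _ _))// normrZ -/x mulrDl mul1r addrC.
  by rewrite lerD// mulrC.
have -> : Phi (f s) - Phi (f t) - (s - t) *: dot gt_ l
    = (Phi (f s) - Phi (f t) - dot gt_ (f s - f t)) + dot gt_ w.
  by rewrite fE dotDr dotZr /GRing.scale/=; ring.
rewrite (le_trans (ler_normD _ _))// [e]splitr mulrDl lerD//; last first.
  exact: le_trans (dot_norm_le _ _) w2.
apply: (le_trans (hPhi _ _)).
have : `|f s - f t| ^+ 2 <= ((`|l| + 1) * x) ^+ 2.
  by rewrite ler_pXn2r ?nnegrE// mulr_ge0// addr_ge0.
move=> /(ler_wpM2l K0)/le_trans; apply.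
rewrite exprMn mulrA expr2 mulrA ler_wpM2r//.
move: se; rewrite ltr_pdivlMr// => /ltW/(le_trans _); apply.
by rewrite -expr2 mulrC ler_wpM2l// lerDl.
Qed.

End strong_derivative.

(** * Nonlinear and lattice operators *)

Section nemytskii.
Variables (R : realType) (T : choiceType) (g G : R -> R) (K : R).
Hypotheses (g0 : g 0 = 0) (g_lip : forall a b, `|g a - g b| <= K * `|a - b|)
  (G0 : G 0 = 0) (G_ge0 : forall a, 0 <= G a)
  (G_taylor : forall a b, 0 <= G a - G b - g b * (a - b) <= K * (a - b) ^+ 2).
Local Notation l2 := (ell2 R T).

Lemma nemytskii_subproof (u : l2) : (fun n => g (u n)) \in @ell2_pred R T.
Proof.
apply: (@dominated_ell2 _ _ _ u K) => n.
by have := g_lip (u n) 0; rewrite g0 !subr0.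
Qed.

Definition nemytskii (u : l2) : l2 := Ell2 (nemytskii_subproof u).

Let K_ge0 : 0 <= K.
Proof. by have := g_lip 1 0; rewrite subr0 normr1 mulr1; exact: le_trans. Qed.

Lemma nemytskii_lip (u v : l2) : `|nemytskii u - nemytskii v| <= K * `|u - v|.
Proof. by apply: norm_ell2_mono K_ge0 _ => n; exact: g_lip. Qed.

Definition potential (u : l2) : R := sumr (fun n => G (u n)).

Lemma potential_summable (u : l2) : pos_summable (fun n => G (u n)).
Proof.
split=> //; apply: le_lt_trans (ltry (K * `|u| ^+ 2)).
apply: (@esum_seq_le _ _ (fun n => G (u n))) => s us.
apply: (@le_trans _ _ (K * \sum_(n <- s) u n ^+ 2)).
  rewrite mulr_sumr; apply: ler_sum => n _.
  by have /andP[_] := G_taylor (u n) 0; rewrite G0 g0 mul0r !subr0.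
by rewrite ler_wpM2l// sum_sqr_le_norm.
Qed.

(** Since [dot] is a polarization, the pairing is traded for the squared norms of [h + d], [h] and
    [d]; each side of [G_taylor] then becomes a pointwise inequality between five series. *)
Lemma potential_taylor (a b : l2) :
  `|potential a - potential b - dot (nemytskii b) (a - b)| <= K * `|a - b| ^+ 2.
Proof.
set d := a - b; set h := nemytskii b.
have comb c1 c2 c3 c4 c5 :
    (forall n, 0 <= c1 * G (a n) + (c2 * G (b n) + (c3 * (h + d) n ^+ 2
      + (c4 * h n ^+ 2 + c5 * d n ^+ 2)))) ->
    0 <= c1 * potential a + (c2 * potential b + (c3 * `|h + d| ^+ 2
      + (c4 * `|h| ^+ 2 + c5 * `|d| ^+ 2))).
  move=> hn; have := @sumr_comb_ge0 R T [:: (c1, fun n => G (a n));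
    (c2, fun n => G (b n)); (c3, fun n => (h + d) n ^+ 2);
    (c4, fun n => h n ^+ 2); (c5, fun n => d n ^+ 2)].
  rewrite !big_cons !big_nil !addr0 -!sqr_norm_ell2; apply=> [p|n]; last first.
    by rewrite !big_cons big_nil addr0; exact: hn.
  rewrite !inE => /orP[/eqP->|/orP[/eqP->|/orP[/eqP->|/orP[/eqP->|/eqP->]]]];
    first [exact: potential_summable | exact: (sqr_summable (h + d))
      | exact: (sqr_summable h) | exact: (sqr_summable d)].
have h1 : 0 <= 1 * potential a + (-1 * potential b + ((- (1/2)) * `|h + d| ^+ 2
      + (1/2 * `|h| ^+ 2 + 1/2 * `|d| ^+ 2))).
  apply: comb => n; have /andP[+ _] := G_taylor (a n) (b n).
  have -> : (h + d) n = g (b n) + (a n - b n) by [].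
  have -> : h n = g (b n) by [].
  have -> : d n = a n - b n by [].
  by move=> H; lra.
have h2 : 0 <= -1 * potential a + (1 * potential b + (1/2 * `|h + d| ^+ 2
      + ((- (1/2)) * `|h| ^+ 2 + (K - 1/2) * `|d| ^+ 2))).
  apply: comb => n; have /andP[_] := G_taylor (a n) (b n).
  have -> : (h + d) n = g (b n) + (a n - b n) by [].
  have -> : h n = g (b n) by [].
  have -> : d n = a n - b n by [].
  by move=> H; lra.
have h3 : 0 <= K * `|d| ^+ 2 by rewrite mulr_ge0// sqr_ge0.
by rewrite /dot ler_norml; apply/andP; split; lra.
Qed.

End nemytskii.

Section lattice.
Variables (R : realType) (N : nat).
Local Notation l2 := (ell2 R 'rV[int]_N).
Implicit Types (u v : l2) (a : 'rV[int]_N).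

Lemma norm_translate a u : `|translate a u| = `|u|.
Proof.
rewrite !ell2_normE; congr (Num.sqrt (fine _)); symmetry.
apply: (reindex_esum _ _ (fun n => n + a) (fun n => ((u n) ^+ 2)%:E)).
split=> //=; first by move=> x y _ _ /addIr.
by move=> y _; exists (y - a) => //; rewrite subrK.
Qed.

Lemma translateD a u v : translate a (u + v) = translate a u + translate a v.
Proof. exact: val_inj. Qed.

Lemma translateZ a (c : R) u : translate a (c *: u) = c *: translate a u.
Proof. exact: val_inj. Qed.

Lemma translateK a u : translate a (translate (- a) u) = u.
Proof. by apply: val_inj; apply/funext => n /=; rewrite addrK. Qed.

Lemma dot_translate a u v : dot (translate a u) v = dot u (translate (- a) v).
Proof.
by rewrite /dot -[in LHS](translateK a v) -translateD !norm_translate.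
Qed.

Lemma dot_translate2 a u v : dot (translate a u) (translate a v) = dot u v.
Proof. by rewrite /dot -translateD !norm_translate. Qed.

(** Summation by parts: translations are isometries, and the adjoint of a translation is the
    opposite one. *)
Lemma sum_dot_nabla u v : \sum_(k < N) dot (nabla k u) (nabla k v) = - dot (lap
  u) v.
Proof.
rewrite /lap dot_suml -sumrN; apply: eq_bigr => k _.
rewrite /nabla !dotBl !dotBr !dotDl dot_translate2 dotZl.
have -> : dot u (translate (unit_vec k) v) = dot (translate (- unit_vec k) u) v.
  by rewrite dot_translate opprK.
by ring.
Qed.

Lemma lapD u v : lap (u + v) = lap u + lap v.
Proof.
rewrite /lap -big_split; apply: eq_bigr => k _ /=.
by rewrite !translateD scalerDr opprD (addrACA (translate _ u)) [LHS]addrACA.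
Qed.

Lemma lapZ (c : R) u : lap (c *: u) = c *: lap u.
Proof.
rewrite /lap scaler_sumr; apply: eq_bigr => k _.
by rewrite !translateZ !scalerDr scalerN !scalerA [2 * c]mulrC.
Qed.

Lemma lapB u v : lap (u - v) = lap u - lap v.
Proof. by rewrite lapD -scaleN1r lapZ scaleN1r. Qed.

Lemma norm_lap u : `|lap u| <= (4 * N)%:R * `|u|.
Proof.
rewrite /lap (le_trans (ler_norm_sum _ _ _))//.
apply: (@le_trans _ _ (\sum_(k < N) 4 * `|u|)).
  apply: ler_sum => k _; rewrite (le_trans (ler_normB _ _))// normrZ.
  rewrite (le_trans (lerD (ler_normD _ _) (lexx _)))// !norm_translate.
  by rewrite normr_nat; lra.
by rewrite sumr_const card_ord natrM -mulrA mulrCA -[leLHS]mulr_natl.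
Qed.

Lemma dot_lap u v : dot (lap u) v = dot u (lap v).
Proof.
apply: oppr_inj; rewrite -sum_dot_nabla (dotC u) -sum_dot_nabla.
by apply: eq_bigr => k _; rewrite dotC.
Qed.

Lemma dotuu u : dot u u = `|u| ^+ 2.
Proof.
by rewrite /dot -mulr2n -scaler_nat normrZ exprMn normr_nat; lra.
Qed.

Lemma norm21_sqr (m : R) u : 0 <= m ->
  norm21 m u ^+ 2 = dot (m *: u - lap u) u.
Proof.
move=> m0; rewrite /norm21 sqr_sqrtr; last first.
  by rewrite addr_ge0 ?mulr_ge0 ?sqr_ge0// sumr_ge0// => k _; exact: sqr_ge0.
rewrite dotBl dotZl dotuu -sum_dot_nabla addrC.
by congr (_ + _); apply: eq_bigr => k _; rewrite dotuu.
Qed.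

Lemma norm21_ge (m : R) u : 0 <= m -> m * `|u| ^+ 2 <= norm21 m u ^+ 2.
Proof.
move=> m0; rewrite /norm21 [leRHS]sqr_sqrtr.
  by rewrite lerDr sumr_ge0// => k _; exact: sqr_ge0.
by rewrite addr_ge0 ?mulr_ge0 ?sqr_ge0// sumr_ge0// => k _; exact: sqr_ge0.
Qed.

(** For a quadratic form the Taylor remainder is the form evaluated at [u - v]; its size follows
    from [norm_lap]. *)
Lemma norm21_taylor (m : R) u v : 0 <= m ->
  `|norm21 m u ^+ 2 - norm21 m v ^+ 2 - dot (2 *: (m *: v - lap v)) (u - v)|
  <= (m + (4 * N)%:R) * `|u - v| ^+ 2.
Proof.
move=> m0; rewrite !norm21_sqr//.
have -> : dot (m *: u - lap u) u - dot (m *: v - lap v) v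
    - dot (2 *: (m *: v - lap v)) (u - v) = dot (m *: (u - v) - lap (u - v)) (u
      - v).
  rewrite lapB !(dotBr, dotBl, dotZl).
  by rewrite (dot_lap u v) (dotC u (lap v)) (dotC u v); ring.
rewrite (le_trans (dot_norm_le _ _))// expr2 mulrA ler_wpM2r//.
rewrite (le_trans (ler_normB _ _))// normrZ ger0_norm// mulrDl lerD2l.
exact: norm_lap.
Qed.

End lattice.

(** * The power nonlinearity and its truncation *)

Section power_nonlinearity.
Variable R : realType.
Implicit Types a b c s x y : R.

Lemma powRS x r : 0 <= x -> 0 < r -> x `^ (r + 1) = x `^ r * x.
Proof.
by move=> x0 r0; rewrite powRD ?powRr1// gt_eqF// addr_gt0.
Qed.

(** Young's inequality with exponents [r + 1] and [(r + 1) / r], read as the tangent inequality for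
    [x ^ (r + 1)] at [y]. It stands in for differential calculus in the Lipschitz bound, the
    convexity of the potential and the minimum of [theta]. *)
Lemma young_powR x y r : 0 <= x -> 0 <= y -> 0 < r ->
  (r + 1) * (x * y `^ r) <= x `^ (r + 1) + r * y `^ (r + 1).
Proof.
move=> x0 y0 r0; have r1 : 0 < r + 1 by rewrite addr_gt0.
have := @conjugate_powR _ x (y `^ r) (r + 1) ((r + 1) / r) x0 (powR_ge0 _ _) r1.
rewrite divr_gt0// invf_div => /(_ isT).
rewrite -powRrM (_ : r * ((r + 1) / r) = r + 1) => [H|]; last first.
  by field; rewrite gt_eqF.
have {}H : x * y `^ r <= x `^ (r + 1) / (r + 1) + y `^ (r + 1) * (r / (r + 1)).
  by apply: H; field; rewrite gt_eqF.
have := ler_wpM2l (ltW r1) H; rewrite (_ : (r + 1) * (_ + _) =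
  x `^ (r + 1) + r * y `^ (r + 1))//.
by field; rewrite gt_eqF.
Qed.

Variables (sigma M : R).
Hypotheses (sigma0 : 0 < sigma) (hM : 0 <= M).

Definition power_nl s : R := `|s| `^ (2 * sigma) * s.

Let s2 : 0 < 2 * sigma. Proof. by rewrite mulr_gt0. Qed.

Lemma power_nlN s : power_nl (- s) = - power_nl s.
Proof. by rewrite /power_nl normrN mulrN. Qed.

Lemma power_nl_ge0E s : 0 <= s -> power_nl s = s `^ (2 * sigma + 1).
Proof. by move=> s0; rewrite /power_nl powRS// ger0_norm. Qed.

(** The slope of [power_nl] at [M], the largest on [[-M, M]]. *)
Let K : R := (2 * sigma + 1) * M `^ (2 * sigma).

Let power_nl_le s : 0 <= s -> s <= M -> 0 <= power_nl s <= K * s.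
Proof.
move=> s0 sM; rewrite /power_nl mulr_ge0 ?powR_ge0//= ler_wpM2r// ger0_norm//.
apply: (@le_trans _ _ (M `^ (2 * sigma))).
  by rewrite ge0_ler_powR ?nnegrE// ltW.
by rewrite /K ler_peMl ?powR_ge0// lerDr ltW.
Qed.

Let power_nl_incr_ge0 b a : 0 <= b -> b <= a -> a <= M ->
  0 <= power_nl a - power_nl b <= K * (a - b).
Proof.
move=> b0 ba aM; have a0 := le_trans b0 ba.
rewrite subr_ge0 !power_nl_ge0E// ge0_ler_powR ?nnegrE ?addr_ge0 ?(ltW s2)//=.
apply: (@le_trans _ _ ((2 * sigma + 1) * (a `^ (2 * sigma)) * (a - b))).
  have := young_powR b0 a0 s2; rewrite (powRS a0)//.
  by move: (b `^ _) (a `^ _) => u v; nra.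
rewrite ler_wpM2r ?subr_ge0// ler_wpM2l ?addr_ge0 ?(ltW s2)//.
by rewrite ge0_ler_powR ?nnegrE// ltW.
Qed.

Lemma power_nl_incr b a : - M <= b -> b <= a -> a <= M ->
  0 <= power_nl a - power_nl b <= K * (a - b).
Proof.
move=> Mb ba aM; have [b0|b0] := leP 0 b; first exact: power_nl_incr_ge0.
have [a0|a0] := leP a 0.
  have := @power_nl_incr_ge0 (- a) (- b).
  rewrite oppr_ge0 lerN2 lerNl !power_nlN => /(_ a0 ba Mb)/andP[h1 h2].
  by apply/andP; split; lra.
have /andP[h1 h2] := power_nl_le (ltW a0) aM.
have := @power_nl_le (- b); rewrite oppr_ge0 lerNl power_nlN => /(_ (ltW b0)
  Mb).
by move=> /andP[h3 h4]; lra.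
Qed.

(* Convexity of [|s| ^ p / p], p = 2 sigma + 2, whose derivative is [power_nl]. *)
Lemma power_nl_tangent a b :
  0 <= `|a| `^ (2 * sigma + 2) / (2 * sigma + 2)
     - `|b| `^ (2 * sigma + 2) / (2 * sigma + 2) - power_nl b * (a - b).
Proof.
have p0 : 0 < 2 * sigma + 2 by rewrite addr_gt0.
have r0 : 0 < 2 * sigma + 1 by rewrite addr_gt0.
have := young_powR (normr_ge0 a) (normr_ge0 b) r0.
have -> : 2 * sigma + 1 + 1 = 2 * sigma + 2 by rewrite -addrA.
have bb : power_nl b * b = `|b| `^ (2 * sigma + 2).
  rewrite (_ : 2 * sigma + 2 = 2 * sigma + 1 + 1) ?powRS ?normr_ge0//; last by
    rewrite -addrA.
  by rewrite /power_nl -!mulrA -!expr2 real_normK ?num_real.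
have ba : power_nl b * a <= `|a| * `|b| `^ (2 * sigma + 1).
  apply: le_trans (ler_norm _) _; rewrite normrM mulrC ler_wpM2l//.
  by rewrite /power_nl normrM ger0_norm ?powR_ge0// powRS.
rewrite mulrBr bb => H.
have := ler_wpM2l (ltW p0) ba.
rewrite -(pmulr_rge0 _ p0).
set A := `|a| `^ _ in H *; set B := `|b| `^ (2 * sigma + 2) in H *.
rewrite (_ : _ * (_ - _) = A + (2 * sigma + 1) * B - (2 * sigma + 2) *
  (power_nl b * a)).
  by rewrite subr_ge0 => /le_trans; apply.
by field; rewrite gt_eqF.
Qed.

Definition clamp s : R := Num.max (- M) (Num.min M s).

Lemma clamp_bound s : - M <= clamp s <= M.
Proof.
have MM : - M <= M by rewrite (le_trans _ hM)// oppr_le0.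
by rewrite /clamp le_max lexx ge_max ge_min lexx MM.
Qed.

Lemma clamp_id s : `|s| <= M -> clamp s = s.
Proof.
by rewrite ler_norml => /andP[h1 h2]; rewrite /clamp (min_idPr h2) (max_idPr
  h1).
Qed.

Lemma clamp_incr b a : b <= a -> 0 <= clamp a - clamp b <= a - b.
Proof.
have MM : - M <= M by rewrite (le_trans _ hM)// oppr_le0.
move=> ba; rewrite /clamp /Num.max /Num.min.
by do ?case: ifPn; rewrite -?leNgt => *; apply/andP; split; lra.
Qed.

Definition trunc_nl s : R := power_nl (clamp s).

(* The tangent-line extension of [|s| ^ p / p] outside [-M, M]; it stays convex
   with derivative [trunc_nl]. *)
Definition trunc_pot s : R :=
  `|clamp s| `^ (2 * sigma + 2) / (2 * sigma + 2) + trunc_nl s * (s - clamp s).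

Lemma trunc_nl0 : trunc_nl 0 = 0.
Proof. by rewrite /trunc_nl clamp_id ?normr0// /power_nl mulr0. Qed.

Lemma trunc_nl_incr b a : b <= a -> 0 <= trunc_nl a - trunc_nl b <= K * (a - b).
Proof.
move=> ba; have /andP[c1 c2] := clamp_incr ba.
have /andP[a1 a2] := clamp_bound a; have /andP[b1 b2] := clamp_bound b.
have := @power_nl_incr (clamp b) (clamp a) b1 _ a2.
rewrite -subr_ge0 => /(_ c1)/andP[-> /= /le_trans]; apply.
by rewrite ler_wpM2l// mulr_ge0 ?powR_ge0// addr_ge0// ltW.
Qed.

Lemma trunc_nl_lip a b : `|trunc_nl a - trunc_nl b| <= K * `|a - b|.
Proof.
have [ba|ba] := leP b a.
  by have /andP[h1 h2] := trunc_nl_incr ba; rewrite !ger0_norm// subr_ge0.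
have /andP[h1 h2] := trunc_nl_incr (ltW ba).
by rewrite distrC (distrC a) !ger0_norm// subr_ge0 ltW.
Qed.

(** The remainder is that of the pure power at the clamped points plus [(trunc_nl a - trunc_nl b) *
    (a - clamp a)]. The latter is nonnegative: if [a] leaves [[-M, M]], then [trunc_nl a] is
    extremal on the same side. *)
Let trunc_pot_tangent a b :
  0 <= trunc_pot a - trunc_pot b - trunc_nl b * (a - b).
Proof.
have := power_nl_tangent (clamp a) (clamp b).
have : 0 <= (trunc_nl a - trunc_nl b) * (a - clamp a).
  have /andP[a1 a2] := clamp_bound a; have /andP[b1 b2] := clamp_bound b.
  have [h|h] := leP (clamp a) a.
    have [e|ne] := eqVneq (clamp a) a; first by rewrite e subrr mulr0.
    rewrite mulr_ge0 ?subr_ge0//.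
    have cM : clamp a = M.
      move: h ne {a1 a2}; rewrite /clamp /Num.max /Num.min.
      by do ?case: ifPn; rewrite -?leNgt => *; lra.
    have := @power_nl_incr (clamp b) (clamp a) b1 _ a2.
    by rewrite {1}cM => /(_ b2)/andP[]; rewrite subr_ge0.
  rewrite mulr_le0// ?subr_le0//; last exact: ltW.
  have cM : clamp a = - M.
    move: h {a1 a2}; rewrite /clamp /Num.max /Num.min.
    by do ?case: ifPn; rewrite -?leNgt => *; lra.
  have := @power_nl_incr (clamp a) (clamp b) a1 _ b2.
  by rewrite {1}cM => /(_ b1)/andP[]; rewrite subr_ge0.
rewrite /trunc_pot /trunc_nl.
by move=> h1 h2; lra.
Qed.

(** Convexity with [a] and [b] exchanged bounds the remainder by
    [(trunc_nl a - trunc_nl b) * (a - b)], and the Lipschitz bound concludes. *)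
Lemma trunc_pot_taylor a b :
  0 <= trunc_pot a - trunc_pot b - trunc_nl b * (a - b) <= K * (a - b) ^+ 2.
Proof.
rewrite trunc_pot_tangent/=; have := trunc_pot_tangent b a.
suff : (trunc_nl a - trunc_nl b) * (a - b) <= K * (a - b) ^+ 2 by lra.
apply: le_trans (ler_norm _) _; rewrite normrM.
rewrite -[(a - b) ^+ 2]real_normK ?num_real// expr2 mulrA ler_wpM2r//.
exact: trunc_nl_lip.
Qed.

Lemma trunc_pot0 : trunc_pot 0 = 0.
Proof.
rewrite /trunc_pot trunc_nl0 mul0r addr0 clamp_id ?normr0// powR0 ?mul0r//.
by rewrite gt_eqF// addr_gt0.
Qed.

Lemma trunc_pot_ge0 s : 0 <= trunc_pot s.
Proof.
by have := trunc_pot_tangent s 0; rewrite trunc_nl0 trunc_pot0 mul0r !subr0.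
Qed.

(** [trunc_pot s] is the value at [s] of the tangent to the convex power at [clamp s]. *)
Lemma trunc_pot_le s :
  trunc_pot s <= `|s| `^ (2 * sigma + 2) / (2 * sigma + 2).
Proof.
have := power_nl_tangent s (clamp s); rewrite /trunc_pot /trunc_nl; lra.
Qed.

End power_nonlinearity.

(** * The Klein-Gordon flow *)

Section klein_gordon_flow.
Variables (R : realType) (N : nat) (m : R) (g G : R -> R) (K : R).
Hypotheses (m_ge0 : 0 <= m)
  (g0 : g 0 = 0) (g_lip : forall a b, `|g a - g b| <= K * `|a - b|)
  (G0 : G 0 = 0) (G_ge0 : forall a, 0 <= G a)
  (G_taylor : forall a b, 0 <= G a - G b - g b * (a - b) <= K * (a - b) ^+ 2).
Local Notation l2 := (ell2 R 'rV[int]_N).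
Local Notation nem := (nemytskii g0 g_lip).
Local Notation pot := (@potential R 'rV[int]_N G).

Definition kg_force (u : l2) : l2 := lap u - m *: u + nem u.

Lemma kg_force_lip u v :
  `|kg_force u - kg_force v| <= ((4 * N)%:R + m + K) * `|u - v|.
Proof.
have -> : kg_force u - kg_force v = lap (u - v) - m *: (u - v) + (nem u - nem
  v).
  by rewrite /kg_force lapB scalerBr !opprD !opprK addrACA [in LHS](addrACA
    (lap u)).
rewrite !mulrDl (le_trans (ler_normD _ _))// lerD//; last exact: nemytskii_lip.
rewrite (le_trans (ler_normB _ _))// normrZ (ger0_norm m_ge0) lerD2r.
exact: norm_lap.
Qed.

Let pot_energy (u : l2) : R := norm21 m u ^+ 2 - 2 * pot u.

Let pot_energy_taylor a b :
  `|pot_energy a - pot_energy b - dot (- 2 *: kg_force b) (a - b)|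
  <= (m + (4 * N)%:R + 2 * K) * `|a - b| ^+ 2.
Proof.
rewrite (_ : pot_energy a - _ - _ =
  (norm21 m a ^+ 2 - norm21 m b ^+ 2 - dot (2 *: (m *: b - lap b)) (a - b))
  - 2 * (pot a - pot b - dot (nem b) (a - b))); last first.
  rewrite /pot_energy /kg_force !(dotZl, dotDl, dotNl); ring.
rewrite [leRHS]mulrDl (le_trans (ler_normB _ _))// lerD ?norm21_taylor//.
rewrite normrM ger0_norm// -mulrA ler_wpM2l//.
exact: potential_taylor.
Qed.

Let sqr_norm_taylor (a b : l2) :
  `| `|a| ^+ 2 - `|b| ^+ 2 - dot (2 *: b) (a - b)| <= 1 * `|a - b| ^+ 2.
Proof.
have -> : `|a| ^+ 2 - `|b| ^+ 2 - dot (2 *: b) (a - b) = `|a - b| ^+ 2.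
  by rewrite -!dotuu !(dotZl, dotBr, dotBl) (dotC a b); ring.
by rewrite mul1r ger0_norm// sqr_ge0.
Qed.

(** The gradient of [pot_energy] is [-2 *: kg_force], so its derivative along the flow cancels that
    of [|z| ^ 2]. Continuity carries the identity down to time 0. *)
Lemma energy_conserved (y z : R -> l2) :
  {within `[0, +oo[, continuous y} -> {within `[0, +oo[, continuous z} ->
  (forall n (t : R), 0 < t -> is_derive t 1 (fun s => y s n) (z t n)) ->
  (forall n (t : R), 0 < t -> is_derive t 1 (fun s => z s n) (kg_force (y t)
    n)) ->
  forall t, 0 <= t ->
  `|z t| ^+ 2 + norm21 m (y t) ^+ 2 - 2 * pot (y t)
  = `|z 0| ^+ 2 + norm21 m (y 0) ^+ 2 - 2 * pot (y 0).
Proof.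
move=> cy cz dy dz t t0.
have K0 : 0 <= K by have := g_lip 1 0; rewrite subr0 normr1 mulr1; exact:
  le_trans.
have C0 : 0 <= m + (4 * N)%:R + 2 * K by rewrite !addr_ge0// mulr_ge0.
have cF : {within `[0, +oo[, continuous (fun s => kg_force (y s))}.
  apply: (@within_continuous_comp R l2 l2 _ y kg_force cy).
  exact: (@lipschitz_fun_continuous R l2 l2 _ _ kg_force_lip).
pose e s := pot_energy (y s) + `|z s| ^+ 2.
have de (s : R) : 0 < s -> is_derive s 1 e 0.
  move=> s0.
  have h1 := quadratic_chain_rule C0 pot_energy_taylor s0
    (coordinatewise_diff_within cy cz dy (ltW s0)).
  have h2 := quadratic_chain_rule ler01 sqr_norm_taylor s0
    (coordinatewise_diff_within cz cF dz (ltW s0)).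
  have := is_deriveD h1 h2.
  by rewrite !dotZl [dot (kg_force _) _]dotC mulNr addNr.
have ce : {within `[0, +oo[, continuous e}.
  have c1 := @within_continuous_comp R l2 R _ _ _ cy (quadratic_continuous
    pot_energy_taylor).
  have c2 := @within_continuous_comp R l2 R _ _ _ cz (quadratic_continuous
    sqr_norm_taylor).
  exact: (within_continuousD c1 c2).
have cet : {within `[0, t], continuous e}.
  apply: continuous_subspaceW ce => s /=.
  by rewrite !in_itv/= => /andP[-> _].
have [|c _] := @MVT_segment R e (fun=> 0) 0 t t0 _ cet.
  by move=> s; rewrite in_itv/= => /andP[s0 _]; exact: de.
by rewrite mul0r /e /pot_energy => h; lra.
Qed.

End klein_gordon_flow.

(** * The critical point and the minimum of theta *)

Section threshold.
Variables (R : realType) (m sigma : R).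
Hypotheses (m_gt0 : 0 < m) (sigma_gt0 : 0 < sigma).

Let sigma1_gt0 : 0 < sigma + 1. Proof. by rewrite addr_gt0. Qed.

(** The positive zero of the derivative of [theta], that is [y ^ sigma = m ^ (sigma + 1)]. *)
Let y := m `^ ((sigma + 1) / sigma).

Let y_sigma : y `^ sigma = m `^ (sigma + 1).
Proof. by rewrite -powRrM divfK// gt_eqF. Qed.

Let theta_mul x : 0 <= x ->
  (sigma + 1) * y `^ sigma * theta m sigma x
  = x `^ (sigma + 1) - (sigma + 1) * (x * y `^ sigma).
Proof.
move=> x0; rewrite /theta /M0 y_sigma [1 + sigma]addrC.
have p0 := powR_gt0 (sigma + 1) m_gt0.
by field; rewrite !gt_eqF.
Qed.

Lemma theta_ge x : 0 <= x ->
  - (sigma / (sigma + 1) * m `^ ((sigma + 1) / sigma)) <= theta m sigma x.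
Proof.
move=> x0; have y0 : 0 <= y by exact: powR_ge0.
have p0 : 0 < (sigma + 1) * y `^ sigma.
  by rewrite mulr_gt0// y_sigma powR_gt0.
rewrite -(ler_pM2l p0) theta_mul// -/y.
have := young_powR x0 y0 sigma_gt0; rewrite (powRS y0)//.
rewrite (_ : _ * - _ = - (sigma * (y `^ sigma * y))); first by lra.
by field; rewrite gt_eqF.
Qed.

Lemma theta_threshold_lt0 : theta m sigma (m `^ ((sigma + 1) / sigma)) < 0.
Proof.
have y0 : 0 < y by exact: powR_gt0.
have p0 : 0 < (sigma + 1) * y `^ sigma.
  by rewrite mulr_gt0// y_sigma powR_gt0.
rewrite -(pmulr_rlt0 _ p0) theta_mul ?(ltW y0)// (powRS (ltW y0))//.
rewrite (_ : _ - _ = - (sigma * (y `^ sigma * y))); last by rewrite -/y; ring.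
by rewrite oppr_lt0 !mulr_gt0// y_sigma powR_gt0.
Qed.

Lemma threshold_sqr :
  m `^ ((sigma + 1) / sigma) = m * (m `^ (2 * sigma)^-1) ^+ 2.
Proof.
rewrite -powR_mulrn ?powR_ge0// -powRrM -{2}(powRr1 (ltW m_gt0)) -powRD; last
  first.
  by rewrite (gt_eqF m_gt0) implybT.
by congr (_ `^ _); field; rewrite gt_eqF.
Qed.

End threshold.

(** * Small solutions of the Klein-Gordon equation *)

Section klein_gordon.
Variables (R : realType) (N : nat) (m sigma : R).
Hypotheses (m_gt0 : 0 < m) (sigma_gt0 : 0 < sigma).
Local Notation l2 := (ell2 R 'rV[int]_N).
Local Notation force M hM :=
  (@kg_force R N m (trunc_nl sigma M) _ (trunc_nl0 sigma hM)
     (trunc_nl_lip sigma_gt0 hM)).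

Lemma solution_trunc (phi0 phi1 : l2) (T : \bar R) (phi dphi : R -> l2) (M : R)
    (hM : 0 <= M) n (t : R) :
  is_solution m sigma phi0 phi1 T phi dphi -> 0 < t -> (t%:E < T)%E ->
  `|phi t| <= M ->
  is_derive t 1 (fun s => phi s n) (dphi t n) /\
  is_derive t 1 (fun s => dphi s n) (force M hM (phi t) n).
Proof.
move=> [_ _ _ _ eqs] t0 tT phiM; have [d1 d2 e] := eqs t n t0 tT; split => //.
have -> : force M hM (phi t) n = derive1 (fun s => dphi s n) t.
  rewrite -[RHS]subr0 -e.
  have -> : force M hM (phi t) n
      = lap (phi t) n - m * phi t n + trunc_nl sigma M (phi t n) by [].
  rewrite /trunc_nl clamp_id ?(le_trans (ell2_coord_le _ _))// /power_nl; ring.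
by split => //; rewrite derive1E.
Qed.

Lemma trunc_solution (phi0 phi1 : l2) (phi dphi : R -> l2) (M : R) (hM : 0 <=
  M) :
  continuous phi -> continuous dphi -> phi 0 = phi0 -> dphi 0 = phi1 ->
  (forall n (t : R), 0 < t -> is_derive t 1 (fun s => phi s n) (dphi t n)) ->
  (forall n (t : R), 0 < t ->
     is_derive t 1 (fun s => dphi s n) (force M hM (phi t) n)) ->
  (forall t, 0 < t -> `|phi t| <= M) ->
  is_solution m sigma phi0 phi1 +oo phi dphi.
Proof.
move=> c1 c2 i1 i2 d1 d2 hphi; split => //.
- exact: continuous_subspaceT.
- exact: continuous_subspaceT.
- move=> t n t0 _; split; first exact: d1.
    by have [] := d2 n t t0.
  have [_] := d2 n t t0; rewrite derive1E => ->.
  have -> : force M hM (phi t) n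
      = lap (phi t) n - m * phi t n + trunc_nl sigma M (phi t n) by [].
  rewrite /trunc_nl clamp_id ?(le_trans (ell2_coord_le _ _)) ?hphi// /power_nl.
  ring.
Qed.

Lemma segment_sub_lifespan (T : \bar R) (B : R) : (B%:E < T)%E ->
  `[0, B]%classic `<=` lifespan T.
Proof.
move=> BT t /=; rewrite in_itv/= => /andP[t0 tB]; split => //.
by apply: le_lt_trans BT; rewrite lee_fin.
Qed.

(** The power is only locally Lipschitz, but both solutions are bounded on [[0, t]]. Truncating at a
    common bound, they solve one and the same globally Lipschitz equation there. *)
Lemma solution_unique (phi0 phi1 : l2) (T : \bar R) (phi dphi psi dpsi : R ->
  l2) :
  is_solution m sigma phi0 phi1 T phi dphi ->
  is_solution m sigma phi0 phi1 T psi dpsi ->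
  forall t, lifespan T t -> phi t = psi t /\ dphi t = dpsi t.
Proof.
move=> sphi spsi t [t0 tT].
have [_ c1 c2 [i1 i2] _] := sphi; have [_ c1' c2' [i1' i2'] _] := spsi.
have sub := segment_sub_lifespan tT.
have {}c1 := continuous_subspaceW sub c1; have {}c2 := continuous_subspaceW sub
  c2.
have {}c1' := continuous_subspaceW sub c1'; have {}c2' := continuous_subspaceW
  sub c2'.
have [C C0 hC] := continuous_norm_bounded c1.
have [C' C'0 hC'] := continuous_norm_bounded c1'.
pose M := Num.max C C'; have hM : 0 <= M by rewrite le_max C0.
have L0 : 0 <= (4 * N)%:R + m + (2 * sigma + 1) * M `^ (2 * sigma).
  by rewrite !addr_ge0 ?(ltW m_gt0)// mulr_ge0 ?powR_ge0// addr_ge0//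
    mulr_ge0// ltW.
have lip := @kg_force_lip R N m _ _ (ltW m_gt0) (trunc_nl0 sigma hM)
  (trunc_nl_lip sigma_gt0 hM).
have D1 n (s : R) : 0 < s < t -> is_derive s 1 (fun x => phi x n) (dphi s n) /\
    is_derive s 1 (fun x => dphi x n) (force M hM (phi s) n).
  move=> /andP[s0 st]; apply: (solution_trunc hM n sphi) => //.
    by apply: lt_trans tT; rewrite lte_fin.
  by rewrite /M le_max hC// !ltW.
have D2 n (s : R) : 0 < s < t -> is_derive s 1 (fun x => psi x n) (dpsi s n) /\
    is_derive s 1 (fun x => dpsi x n) (force M hM (psi s) n).
  move=> /andP[s0 st]; apply: (solution_trunc hM n spsi) => //.
    by apply: lt_trans tT; rewrite lte_fin.
  by rewrite /M le_max hC' ?orbT// !ltW.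
apply: (global_ode_unique L0 lip c1 c2 c1' c2'); rewrite ?i1 ?i2 ?i1' ?i2' ?t0
  ?lexx//.
- by move=> n s st; case: (D1 n s st).
- by move=> n s st; case: (D1 n s st).
- by move=> n s st; case: (D2 n s st).
- by move=> n s st; case: (D2 n s st).
Qed.

(** The amplitude at which the power term and the mass term of the equation balance. *)
Let M : R := m `^ (2 * sigma)^-1.

Let M_ge0 : 0 <= M. Proof. exact: powR_ge0. Qed.

Let norm_le (u : l2) : norm21 m u ^+ 2 <= m * M ^+ 2 -> `|u| <= M.
Proof.
move=> h; rewrite -(@ler_pXn2r _ 2)// ?nnegrE// -(ler_pM2l m_gt0).
by apply: le_trans h; apply: norm21_ge; exact: ltW.
Qed.

(** All coordinates of [u] lie in [[-M, M]], where [|s| ^ (2 sigma + 2) <= m * s ^ 2]; summing gives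
    the mass term, and [2 / (2 sigma + 2)] is the factor [1 / (sigma + 1)]. *)
Let pot_le (u : l2) : norm21 m u ^+ 2 <= m * M ^+ 2 ->
  2 * potential (trunc_pot sigma M) u <= norm21 m u ^+ 2 / (sigma + 1).
Proof.
move=> h; have uM := norm_le h.
have s1 : 0 < sigma + 1 by rewrite addr_gt0.
have s2 : 0 < 2 * sigma by rewrite mulr_gt0.
rewrite ler_pdivlMr// (le_trans _ (norm21_ge u (ltW m_gt0)))//.
suff : potential (trunc_pot sigma M) u <= m * `|u| ^+ 2 / (2 * sigma + 2).
  rewrite ler_pdivlMr ?addr_gt0//.
  by rewrite (_ : 2 * _ * _ = potential (trunc_pot sigma M) u * (2 * sigma +
    2))//; ring.
rewrite -lee_fin /potential sumrE; last first.
  exact: (potential_summable (trunc_nl0 sigma M_ge0) (trunc_nl_lip sigma_gt0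
    M_ge0) (trunc_pot0 sigma_gt0 M_ge0)
    (trunc_pot_ge0 sigma_gt0 M_ge0) (trunc_pot_taylor sigma_gt0 M_ge0)).
apply: (@esum_seq_le _ _ (fun n => trunc_pot sigma M (u n))) => s us.
apply: (@le_trans _ _ (m / (2 * sigma + 2) * \sum_(n <- s) u n ^+ 2)); last
  first.
  rewrite [leRHS]mulrAC ler_wpM2l ?sum_sqr_le_norm// divr_ge0 ?(ltW m_gt0)//.
  by rewrite addr_ge0// ltW.
rewrite mulr_sumr; apply: ler_sum => n _.
rewrite (le_trans (trunc_pot_le M sigma_gt0 _))// [leRHS]mulrAC.
rewrite ler_wpM2r ?invr_ge0 ?addr_ge0 ?(ltW s2)//.
rewrite powRD; last by rewrite gt_eqF// addr_gt0.
rewrite powR_mulrn// real_normK ?num_real// ler_wpM2r ?sqr_ge0//.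
have -> : m = M `^ (2 * sigma).
  by rewrite /M -powRrM mulVf ?powRr1 ?(ltW m_gt0)// gt_eqF.
rewrite ge0_ler_powR ?nnegrE ?(ltW s2)//.
exact: le_trans (ell2_coord_le _ _) uM.
Qed.

(* Energy conservation forbids [norm21 m (phi t) ^+ 2] to cross the maximum
   point [m * M ^+ 2] of [- theta]. *)
Lemma global_small_solution (phi0 phi1 : l2) :
  norm1_sq m phi0 phi1 < sigma / (sigma + 1) * (m `^ ((sigma + 1) / sigma)) ->
  exists phi dphi : R -> l2,
    [/\ continuous phi, continuous dphi,
        is_solution m sigma phi0 phi1 +oo phi dphi,
        forall t, 0 <= t -> `|phi t| <= M &
        forall t, 0 <= t ->
          norm1_sq m (phi t) (dphi t) <= (1 + sigma) / sigma * norm1_sq m phi0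
            phi1].
Proof.
rewrite threshold_sqr// -/M => E0.
have s1 : 0 < sigma + 1 by rewrite addr_gt0.
have L0 : 0 <= (4 * N)%:R + m + (2 * sigma + 1) * M `^ (2 * sigma).
  by rewrite !addr_ge0 ?(ltW m_gt0)// mulr_ge0 ?powR_ge0// addr_ge0//
    mulr_ge0// ltW.
have lip := @kg_force_lip R N m _ _ (ltW m_gt0) (trunc_nl0 sigma M_ge0)
  (trunc_nl_lip sigma_gt0 M_ge0).
have [[y z] [/= cy cz i0 dyz]] := global_ode_exists L0 lip phi0 phi1.
have [y0 z0] := i0 0 (lexx 0).
have dy n (t : R) : 0 < t -> is_derive t 1 (fun s => y s n) (z t n).
  by move=> /(dyz n)[].
have dz n (t : R) : 0 < t ->
    is_derive t 1 (fun s => z s n) (force M M_ge0 (y t) n).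
  by move=> /(dyz n)[].
have energy := @energy_conserved R N m _ (trunc_pot sigma M) _ (ltW m_gt0)
  (trunc_nl0 sigma M_ge0) (trunc_nl_lip sigma_gt0 M_ge0) (trunc_pot0 sigma_gt0
    M_ge0)
  (trunc_pot_ge0 sigma_gt0 M_ge0) (trunc_pot_taylor sigma_gt0 M_ge0) y z
  (continuous_subspaceT cy) (continuous_subspaceT cz) dy dz.
have pot_ge0 (u : l2) : 0 <= potential (trunc_pot sigma M) u.
  apply/fine_ge0/esum_ge0 => n _; rewrite lee_fin.
  exact: (trunc_pot_ge0 sigma_gt0 M_ge0).
(* The initial potential is dropped as nonnegative, and the one at time [t] takes a share
   [1 / (sigma + 1)] of the norm, leaving [sigma / (sigma + 1)]. *)
have bound t : 0 <= t -> norm21 m (y t) ^+ 2 <= m * M ^+ 2 ->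
    `|z t| ^+ 2 + sigma / (sigma + 1) * norm21 m (y t) ^+ 2 <= norm1_sq m phi0
      phi1.
  move=> /energy; rewrite y0 z0 => e /pot_le; have := pot_ge0 phi0.
  rewrite /norm1_sq (_ : sigma / (sigma + 1) = 1 - (sigma + 1)^-1).
    by lra.
  by field; rewrite gt_eqF.
have sr : sigma / (sigma + 1) <= 1 by rewrite ler_pdivrMr// mul1r lerDl.
have sr0 : 0 < sigma / (sigma + 1) by rewrite divr_gt0.
have mM : 0 <= m * M ^+ 2 by rewrite mulr_ge0 ?sqr_ge0// ltW.
have cx : continuous (fun t => norm21 m (y t) ^+ 2).
  move=> t; apply: (@continuous_comp R l2 R y (fun u => norm21 m u ^+ 2)).
    exact: cy.
  exact: (quadratic_continuous (fun a b => norm21_taylor a b (ltW m_gt0))).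
have x0 : norm21 m (y 0) ^+ 2 < m * M ^+ 2.
  rewrite y0; apply: (@le_lt_trans _ _ (norm1_sq m phi0 phi1)).
    by rewrite /norm1_sq lerDr sqr_ge0.
  by apply: lt_le_trans E0 _; rewrite ler_piMl.
have xt t : 0 <= t -> norm21 m (y t) ^+ 2 < m * M ^+ 2.
  move=> t0; rewrite ltNge; apply/negP => h.
  (* At a time [c] of equality the non-strict hypothesis of [bound] still holds, which forces the
     initial norm up to the threshold excluded by [E0]. *)
  have [|c] := @IVT R (fun t => norm21 m (y t) ^+ 2) 0 t (m * M ^+ 2) t0
    (continuous_subspaceT cx).
    by rewrite ge_min (ltW x0)/= le_max h orbT.
  rewrite in_itv/= => /andP[c0 _] xc.
  have := bound c c0; rewrite xc lexx => /(_ isT).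
  have := sqr_ge0 `|z c|; move: E0; lra.
have yM t : 0 <= t -> `|y t| <= M by move=> t0; apply/norm_le/ltW/xt.
exists y, z; split => //.
  by apply: (trunc_solution cy cz y0 z0 dy dz) => t t0; apply: yM; exact: ltW.
move=> t t0; have := bound t t0 (ltW (xt t t0)) => h.
rewrite -invf_div [1 + sigma]addrC mulrC ler_pdivlMr//; apply: le_trans h.
rewrite /norm1_sq mulrDl [_ * (sigma / _)]mulrC [norm21 _ _ ^+ 2 * _]mulrC
  lerD2r.
by rewrite ler_piMl// sqr_ge0.
Qed.

(** The second derivative is the truncated force along [phi]: it coincides with the true one as long
    as [|phi t| <= M], and its global Lipschitz bound gives continuity in norm. *)
Lemma solution_C2 (phi0 phi1 : l2) (phi dphi : R -> l2) :
  is_solution m sigma phi0 phi1 +oo phi dphi ->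
  (forall t, 0 <= t -> `|phi t| <= M) -> Ck_on 2 `[0, +oo[ phi.
Proof.
move=> sol hM; have [_ c1 c2 _ _] := sol.
have lifeE : lifespan +oo = (`[0, +oo[%classic : set R).
  apply/seteqP; split=> t /=; rewrite in_itv/= andbT; first by case.
  by move=> t0; split => //; exact: ltry.
rewrite lifeE in c1 c2.
have D n (t : R) : 0 < t -> is_derive t 1 (fun s => phi s n) (dphi t n) /\
    is_derive t 1 (fun s => dphi s n) (force M M_ge0 (phi t) n).
  move=> t0; apply: (solution_trunc M_ge0 n sol) => //; first exact: ltry.
  by apply: hM; exact: ltW.
have lip := @kg_force_lip R N m _ _ (ltW m_gt0) (trunc_nl0 sigma M_ge0)
  (trunc_nl_lip sigma_gt0 M_ge0).
have cF : {within `[0, +oo[, continuous (fun s => force M M_ge0 (phi s))}.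
  apply: (@within_continuous_comp R l2 l2 _ phi (force M M_ge0) c1).
  exact: (@lipschitz_fun_continuous R l2 l2 _ _ lip).
split => //; exists dphi.
  move=> t; rewrite /= in_itv/= andbT => t0.
  apply: diff_within_is_derive_within; apply: (coordinatewise_diff_within c1
    c2) => //.
  by move=> n s /(D n)[].
split => //; exists (fun s => force M M_ge0 (phi s)); last by split.
move=> t; rewrite /= in_itv/= andbT => t0.
apply: diff_within_is_derive_within; apply: (coordinatewise_diff_within c2 cF)
  => //.
by move=> n s /(D n)[].
Qed.

End klein_gordon.

Theorem theorem3p2 (R : realType) (N : nat) (hN : (1 <= N)%N)
    (m sigma rho : R) (hm : 0 < m) (hsigma : 0 < sigma)
    (hrho : is_min (theta m sigma @` `[0, +oo[) (- rho)) :
  - rho < 0 /\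
  forall phi0 phi1 : ell2 R 'rV[int]_N,
    norm1_sq m phi0 phi1 <=
      Num.min 1 (rho * m `^ (sigma + 1) * (sigma + 1) /
                 (1 + m `^ (sigma + 1) * (sigma + 1))) ->
  forall (T : \bar R) (phi dphi : R -> ell2 R 'rV[int]_N),
    is_maximal_solution m sigma phi0 phi1 T phi dphi ->
    [/\ T = +oo%E,
        Ck_on 2 `[0, +oo[ phi &
        (ereal_sup [set (norm1_sq m (phi t) (dphi t))%:E | t in `[0%R, +oo[]
         <= ((1 + sigma) / sigma *
             ((1 + m `^ (sigma + 1) * (sigma + 1)) /
              (m `^ (sigma + 1) * (sigma + 1))) *
             norm1_sq m phi0 phi1)%:E)%E].
Proof.
have s1 : 0 < sigma + 1 by rewrite addr_gt0.
have A0 : 0 < m `^ (sigma + 1) * (sigma + 1) by rewrite mulr_gt0// powR_gt0.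
have [[x x0 hx] lb] := hrho; rewrite /= in_itv/= andbT in x0.
have rho_lt0 : - rho < 0.
  apply: le_lt_trans (theta_threshold_lt0 hm hsigma); apply: lb.
  by exists (m `^ ((sigma + 1) / sigma)) => //=; rewrite in_itv/= powR_ge0.
split => // phi0 phi1; rewrite le_min => /andP[_ hE] T phi dphi [sol maxi].
rewrite oppr_lt0 in rho_lt0.
have rho_le : rho <= sigma / (sigma + 1) * m `^ ((sigma + 1) / sigma).
  by rewrite -lerN2 -hx theta_ge.
(* With [A = m ^ (sigma + 1) * (sigma + 1)], the factor [A / (1 + A)] is below 1 and [rho > 0],
   which turns the weak smallness assumption into a strict one. *)
have E_lt : norm1_sq m phi0 phi1
    < sigma / (sigma + 1) * m `^ ((sigma + 1) / sigma).
  apply: lt_le_trans rho_le; apply: le_lt_trans hE _.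
  by rewrite ltr_pdivrMr ?addr_gt0// -mulrA [ltRHS]mulrDr mulr1 ltrDr.
have [y [z [cy cz ysol yM yE]]] := global_small_solution hm hsigma E_lt.
have agree : forall t, lifespan T t -> y t = phi t /\ z t = dphi t.
  apply: (solution_unique hm hsigma _ sol); have [T0 _ _ _ _] := sol.
  have [_ _ _ ini eqs] := ysol; split => //.
  - exact: continuous_subspaceT.
  - exact: continuous_subspaceT.
  - by move=> t n t0 _; apply: eqs => //; exact: ltry.
have Too : T = +oo%E by rewrite -(maxi +oo%E y z (leey T) ysol agree).
have life t : 0 <= t -> lifespan T t.
  by rewrite Too => t0; split => //; exact: ltry.
split => //.
  rewrite Too in sol; apply: (solution_C2 hm hsigma sol) => t t0.
  by have [<- _] := agree t (life t t0); exact: yM.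
apply: ge_ereal_sup => _ [t + <-]; rewrite /= in_itv/= andbT => t0.
have [<- <-] := agree t (life t t0); rewrite lee_fin (le_trans (yE t t0))//.
have E0 : 0 <= norm1_sq m phi0 phi1 by rewrite /norm1_sq addr_ge0// sqr_ge0.
(* The bound already holds with [(1 + sigma) / sigma]; the other factor [(1 + A) / A] is at least
   1. *)
rewrite ler_wpM2r// ler_peMr ?divr_ge0 ?addr_ge0 ?(ltW hsigma)//.
by rewrite ler_pdivlMr// mul1r lerDr.
Qed.
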